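(* Fix $T>0$, integers $d,q\ge1$, an initial point $y_0\in\mathbb R^q$ and continuous, locally bounded coefficients $b:[0,T]\times\mathbb R^q\to\mathbb R^q$, $\beta^{ij}:[0,T]\times\mathbb R^q\to\mathbb R^q$ ($1\le i,j\le d$) and $\sigma:[0,T]\times\mathbb R^q\to\mathbb R^{q\times d}$. For every $t\in[0,T]$, the law-free solution relation $$\mathcal R_t\subset C([0,t];\mathbb R^d)\times C([0,t];\mathbb R^q)$$ is Borel. The family is compatible with restriction: $$(x,y)\in\mathcal R_T\quad\Longrightarrow\quad(r_tx,r_ty)\in\mathcal R_t.$$
   Context: Continuous path spaces carry the uniform topology; $r_t$ denotes restriction of a path to $[0,t]$. The following is defined for every horizon $u\in[0,T]$. Endogenous integral on $[0,u]$. For integers $m,d\ge 1$, a càdlàg $h:[0,u]\to\mathbb R^{m\times d}$, $x\in C([0,u];\mathbb R^d)$ and $n\ge1$, let $\tau_0^n=0$, $\tau_{k+1}^n=\inf\{s>\tau_k^n:\|h(s)-h(\tau_k^n)\|>2^{-n}\}\wedge u$ (remaining at $u$ once $u$ is reached), and $$I^{n,u}_s(h,x)=\sum_{k\ge0}h(\tau^n_k)\bigl(x(s\wedge\tau^n_{k+1})-x(s\wedge\tau^n_k)\bigr),\quad s\le u.$$ $\widehat{\mathcal D}_u^{m,d}$ is the set of $(h,x)$ for which $I^{n,u}(h,x)$ converges uniformly on $[0,u]$, and $\widehat{\mathcal I}_u(h,x)$ is the limit path. Covariation on $[0,u]$. With $\chi^{ij}_u(x)_s=x^i_se_j^\top$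 ($e_j$ the $j$-th coordinate vector), let $\mathcal D^{(u)}_{\mathrm{qv}}=\bigcap_{i,j}\{x\in C([0,u];\mathbb R^d):(\chi_u^{ij}(x),x)\in\widehat{\mathcal D}_u^{1,d}\}$ and $$\mathcal Q^{ij,(u)}_s(x)=x^i_sx^j_s-x^i_0x^j_0-(\widehat{\mathcal I}_u(\chi_u^{ij}(x),x))_s-(\widehat{\mathcal I}_u(\chi_u^{ji}(x),x))_s .$$ $\mathcal G^{(u)}_{\mathrm{qv}}$ is the set of $x\in\mathcal D^{(u)}_{\mathrm{qv}}$ such that all entries of $\mathcal Q^{(u)}(x)$ are continuous of finite total variation on $[0,u]$. Solution relation. For $y\in C([0,u];\mathbb R^q)$ write $\sigma[y]_s=\sigma(s,y_s)$. $\mathcal R_u$ is the set of $(x,y)\in C([0,u];\mathbb R^d)\times C([0,u];\mathbb R^q)$ such that $x\in\mathcal G_{\mathrm{qv}}^{(u)}$, $(\sigma[y],x)\in\widehat{\mathcal D}_u^{q,d}$ and, for every $s\in[0,u]$, $$y_s=y_0+\int_0^sb(r,y_r)\,dr+\sum_{i,j=1}^d\int_0^s\beta^{ij}(r,y_r)\,d\mathcal Q^{ij,(u)}_r(x)+(\widehat{\mathcal I}_u(\sigma[y],x))_s,$$ where $y_0$ on the right is the fixed initial point and the $d\mathcal Q$-integrals are Riemann–Stieltjes integrals. *)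

(* Defs.v *)
From HB Require Import structures.
From mathcomp Require Import all_boot all_order all_algebra.
From mathcomp Require Import all_classical all_reals all_analysis.

Set Implicit Arguments.
Unset Strict Implicit.
Unset Printing Implicit Defensive.

Import Order.TTheory GRing.Theory Num.Theory.
Import numFieldNormedType.Exports.

Local Open Scope classical_set_scope.
Local Open Scope ring_scope.

Definition borel_set (X : topologicalType) : set (set X) := <<s @open X >>.

(* C([0, u]; R^n): continuous functions on the subtype [0, u] of R. *)
Definition cpath (R : realType) (u : R) (n : nat) : Type :=
  continuousType (set_type `[0, u]%classic) 'cV[R]_n.

HB.instance Definition _ (R : realType) (u : R) (n : nat) :=
  Choice.copy (cpath u n) (continuousType (set_type `[0, u]%classic) 'cV[R]_n).

Definition cpath_uniform (R : realType) (u : R) (n : nat) (x : cpath u n) :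
  {uniform (set_type `[0, u]%classic) -> 'cV[R]_n} := Continuous.sort x.

HB.instance Definition _ (R : realType) (u : R) (n : nat) :=
  Uniform.copy (cpath u n) (initial_topology (@cpath_uniform R u n)).

(* Evaluation of a path at a real time. The value 0 taken outside [0, u] is a
   junk value: everything below evaluates paths on [0, u] only. *)
Definition cpath_eval (R : realType) (u : R) (n : nat) (x : cpath u n) :
  R -> 'cV[R]_n := 'valL_0 (Continuous.sort x).

Coercion cpath_eval : cpath >-> Funclass.

Lemma restr_continuous (R : realType) (n : nat) (t T : R) (tT : t <= T)
  (x : cpath T n) : continuous (sigL `[0, t]%classic (cpath_eval x)).
Proof.
apply/subspace_sigL_continuousP.
have sub : `[0, t]%classic `<=` `[0, T]%classic.
  by move=> s /=; rewrite !in_itv /= => /andP[-> /le_trans]; apply.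
apply: (continuous_subspaceW sub).
by apply/subspace_valL_continuousP'; exact: cts_fun.
Qed.

(* the restriction map r_t : C([0, T]; R^n) -> C([0, t]; R^n) *)
Definition restr (R : realType) (n : nat) (t T : R) (tT : t <= T)
  (x : cpath T n) : cpath t n :=
  (mkcts (@restr_continuous _ _ _ _ tT x) :
    continuousType (set_type `[0, t]%classic) 'cV[R]_n).

Definition locally_bounded_on (R : realType) (X : topologicalType)
    (V : normedModType R) (D : set X) (f : X -> V) : Prop :=
  forall p, D p -> bounded_near f (within D (nbhs p)).

(* Mesh-convergent Riemann-Stieltjes integral of f against g on [a, b];
   xi k is the tag in the k-th interval of the partition a :: s. *)
Definition is_RS_integral (R : realType) (f g : R -> R) (a b v : R) : Prop :=
  forall e : R, 0 < e -> exists2 delta : R, 0 < delta &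
    forall (s : seq R) (xi : nat -> R), itv_partition a b s ->
      (forall k, (k < size s)%N ->
         nth b (a :: s) k <= xi k <= nth b s k /\
         nth b s k - nth b (a :: s) k < delta) ->
      `| \sum_(0 <= k < size s)
           f (xi k) * (g (nth b s k) - g (nth b (a :: s) k)) - v | < e.

Definition RS_integral (R : realType) (f g : R -> R) (a b : R) : R :=
  get (is_RS_integral f g a b).

Definition frobenius (R : realType) (m d : nat) (A : 'M[R]_(m, d)) : R :=
  Num.sqrt (\sum_(i < m) \sum_(j < d) A i j ^+ 2).

(* Integrands h on [0, u] are functions on R of which only the values on
   [0, u] are used. *)
Section endogenous_integral.
Context (R : realType) (u : R) (m d : nat).
Implicit Types (h : R -> 'M[R]_(m, d)) (x : cpath u d).

Definition cadlag h : Prop :=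
  (forall s : R, 0 <= s < u -> h r @[r --> s^'+] --> h s) /\
  (forall s : R, 0 < s <= u -> cvg (h r @[r --> s^'-])).

Fixpoint tau h (n k : nat) : R :=
  if k is k'.+1 then
    let t := tau h n k' in
    let S := [set s | t < s <= u /\ 2 ^- n < frobenius (h s - h t)] in
    fine (Order.min (ereal_inf [set s%:E | s in S]) u%:E)
  else 0.

(* The terms vanish as soon as tau h n k = u. *)
Definition endo_sum h x (n : nat) (s : R) : 'cV[R]_m :=
  limn (series (fun k =>
    h (tau h n k) *m
      (x (Num.min s (tau h n k.+1)) - x (Num.min s (tau h n k))))).

Definition Dhat : set ((R -> 'M[R]_(m, d)) * cpath u d) :=
  [set hx | cadlag hx.1 /\
    exists l : R -> 'cV[R]_m,
      {uniform `[0, u], endo_sum hx.1 hx.2 n @[n --> \oo] --> l}].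

Definition Ihat h x (s : R) : 'cV[R]_m :=
  limn (fun n => endo_sum h x n s).

End endogenous_integral.

Section covariation.
Context (R : realType) (u : R) (d : nat).
Implicit Types (x : cpath u d) (i j : 'I_d).

Definition chi i j x (s : R) : 'M[R]_(1, d) := x s i 0 *: delta_mx 0 j.

Definition Dqv : set (cpath u d) :=
  \bigcap_i \bigcap_j [set x | Dhat (chi i j x, x)].

Definition Qcov i j x (s : R) : R :=
  x s i 0 * x s j 0 - x 0 i 0 * x 0 j 0
  - Ihat (chi i j x) x s 0 0 - Ihat (chi j i x) x s 0 0.

Definition Gqv : set (cpath u d) :=
  [set x | Dqv x /\
    forall i j, {within `[0, u], continuous (Qcov i j x)} /\
                bounded_variation 0 u (Qcov i j x)].

End covariation.

Section solution_relation.
Context (R : realType) (d q : nat) (y0 : 'cV[R]_q).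
Context (b : R * 'cV[R]_q -> 'cV[R]_q).
Context (beta : 'I_d -> 'I_d -> R * 'cV[R]_q -> 'cV[R]_q).
Context (sigma : R * 'cV[R]_q -> 'M[R]_(q, d)).

Definition sigma_along (u : R) (y : cpath u q) (s : R) : 'M[R]_(q, d) :=
  sigma (s, y s).

Definition solution_rel (u : R) : set (cpath u d * cpath u q) :=
  [set xy | let x := xy.1 in let y := xy.2 in
    [/\ Gqv x,
        Dhat (sigma_along y, x) &
        forall s : R, 0 <= s <= u ->
          y s = y0
            + \col_k (\int[lebesgue_measure]_(r in `[0, s]) b (r, y r) k 0)
            + \sum_(i < d) \sum_(j < d)
                \col_k RS_integral (fun r => beta i j (r, y r) k 0)
                                   (Qcov i j x) 0 s
            + Ihat (sigma_along y) x s]].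

End solution_relation.

Arguments solution_rel {R d q} y0 b beta sigma u _.

(* Main.v *)
Require Import Defs.
From HB Require Import structures.
From mathcomp Require Import all_boot all_order all_algebra.
From mathcomp Require Import all_classical all_reals all_analysis.
From mathcomp Require Import measurable_realfun ring lra.
Import Order.TTheory GRing.Theory Num.Theory.
Import numFieldNormedType.Exports.
Local Open Scope classical_set_scope.
Local Open Scope ring_scope.

(** The relation is cut out by conditions on the two paths which are quantified
over an uncountable set of times, and Borel measurability comes from reducing
them to countably many times. The basic notion is that of a process on a
measurable subset [D] of the space of pairs of paths: a family of real
functions of time with continuous paths on [0, u] whose value at each fixed
time is measurable on [D] ([mproc]). Processes are closed under sums, products,
uniform limits and stopping at a measurable time. Because their paths are
continuous, a bound valid at all times, uniform convergence of a sequence of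
processes, and bounded variation can all be tested on dyadic times, and
so define measurable sets ([measurable_mproc_le],
[measurable_mproc_unif_cvg], [measurable_mproc_bounded_variation]).

Each ingredient of the relation is a process on the set where it is meaningful.
The stopping times of a continuous integrand are measurable, since crossing a
level strictly before a given time can be seen at a dyadic time
([measurable_tau]), and by uniform continuity they reach the horizon after
finitely many steps ([tau_end]). Hence the approximating sums are finite sums
of stopped processes, their domain of uniform convergence is measurable
([measurable_Dhat]) and on it the limit is a process ([mproc_Ihat]). The
covariation is therefore a process on its domain. The Riemann-Stieltjes
integral of a continuous function against a function of bounded variation
exists, and is the limit of left-point dyadic sums, uniformly in the upper
bound ([primitive_exists], [primitive_RS_integral], [primitive_unif_cvg]); the
same holds for the Lebesgue integral with the identity as integrator. Both are
thus processes, and the equation says that the difference of two processes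
vanishes at all times.

Restriction is pathwise: the stopping times of the shorter horizon are those of
the longer one truncated at the shorter horizon ([tau_restr]), so that the
approximating sums agree on the shorter interval ([endo_sum_restr]). *)

Set Implicit Arguments.
Unset Strict Implicit.
Unset Printing Implicit Defensive.

(** * Continuity, uniform convergence and dyadic grids on a segment *)

Section continuity_on_segment.
Context {R : realType} (u : R) {V : normedModType R}.
Implicit Types f : R -> V.

(** Uniform continuity on [0, u], in epsilon-delta form. *)
Definition unif_cont f := forall e : R, 0 < e -> exists2 del : R, 0 < del &
  forall r s, 0 <= r <= u -> 0 <= s <= u -> `|r - s| < del -> `|f r - f s| < e.

Lemma within_continuousP f : {within `[0, u], continuous f} <->
  forall r, 0 <= r <= u -> forall e : R, 0 < e -> exists2 del : R, 0 < del &
    forall s, 0 <= s <= u -> `|r - s| < del -> `|f r - f s| < e.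
Proof.
split=> [/subspace_continuousP cf r r0u e e0|cf].
  have /cvgrPdist_lt /(_ e e0) : f @ within `[0, u] (nbhs r) --> f r.
    by apply: cf; rewrite /= in_itv.
  rewrite near_withinE => /nbhs_ballP[del /= del0 H]; exists del => // s s0u rs.
  by apply: H => //; rewrite /= in_itv.
apply/subspace_continuousP => r /=; rewrite in_itv /= => r0u.
apply/cvgrPdist_lt => e e0; have [del del0 H] := cf r r0u e e0.
rewrite near_withinE; apply/nbhs_ballP; exists del => // s rs /=.
by rewrite in_itv /= => s0u; exact: H.
Qed.

Lemma heine_cantor f : {within `[0, u], continuous f} <-> unif_cont f.
Proof.
split=> [/within_continuousP cf|cf]; last first.
  apply/within_continuousP => r r0u e /cf[del del0 H]; exists del => // s s0u.
  exact: H.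
move=> e e0; have e20 : 0 < e / 2 by rewrite divr_gt0.
have /compact_near_coveringP cpt := @segment_compact R 0 u.
have := cpt _ (0^'+ : set_system R) (fun del r => 0 <= r <= u ->
  forall s, 0 <= s <= u -> `|r - s| < del -> `|f r - f s| < e) _.
have key : forall x, `[0, u]%classic x -> \forall x' \near x & i \near 0^'+,
    0 <= x' <= u -> forall s, 0 <= s <= u -> `|x' - s| < i -> `|f x' - f s| < e.
  move=> x /=; rewrite in_itv /= => x0u.
  have [del del0 H] := cf x x0u _ e20.
  exists (ball x (del / 2), [set i | i < del / 2]) => /=.
    split; first by apply: nbhsx_ballx; rewrite divr_gt0.
    by apply: nbhs_right_lt; rewrite divr_gt0.
  move=> [x' i] /= [xx' idel] x'0u s s0u x's.
  have -> : f x' - f s = - (f x - f x') + (f x - f s).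
    by rewrite opprB addrA subrK.
  rewrite (le_lt_trans (ler_normD _ _))// normrN [ltRHS]splitr ltrD//.
    by apply: H => //; apply: lt_trans xx' _; rewrite ltr_pdivrMr// mulr2n; lra.
  apply: H => //; rewrite [del]splitr (_ : x - s = (x - x') + (x' - s)); last first.
    by rewrite addrA subrK.
  by rewrite (le_lt_trans (ler_normD _ _))// ltrD// (lt_trans x's).
move=> /(_ _ key) [del /= del0] H.
exists (del / 2); first by rewrite divr_gt0.
move=> r s r0u s0u rs; apply: (H (del / 2)) => //=.
- by rewrite sub0r normrN gtr0_norm ?divr_gt0// ltr_pdivrMr// mulr2n; lra.
- by rewrite divr_gt0.
Qed.

End continuity_on_segment.

Section uniform_convergence.
Context {R : realType} (u : R) {V : normedModType R}.
Implicit Types (F : nat -> R -> V) (l : R -> V).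

(** Uniform convergence on [0, u], in epsilon form. *)
Definition unif_cvg F l := forall e : R, 0 < e -> exists N, forall n, (N <= n)%N ->
  forall s, 0 <= s <= u -> `|F n s - l s| < e.

Lemma unif_cvgP F l : {uniform `[0, u], F n @[n --> \oo] --> l} <-> unif_cvg F l.
Proof.
split=> [Fl e e0|Fl].
  have [|N _ H] := Fl [set h | forall y, `[0, u]%classic y -> ball (l y) e (h y)].
    apply/uniform_nbhs; exists [set xy | ball xy.1 e xy.2]; split => //.
    exact: (@entourage_ball _ V (PosNum e0)).
  exists N => n /H /= {}H s s0u; rewrite distrC.
  have := H s; rewrite -ball_normE /=; apply; by rewrite in_itv.
move=> P /uniform_nbhs[E [+ EP]]; rewrite -entourage_ballE => -[e /= e0 eE].
have [N H] := Fl e e0; exists N => // n /= Nn; apply: EP => y.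
rewrite /= in_itv /= => y0u; apply: eE => /=.
by rewrite -ball_normE /= distrC; exact: H.
Qed.

Lemma unif_cvg_pointwise F l : unif_cvg F l ->
  forall s, 0 <= s <= u -> F n s @[n --> \oo] --> l s.
Proof.
move=> Fl s s0u; apply/cvgrPdist_lt => e /Fl[N H].
by exists N => // n /= Nn; rewrite distrC; exact: H.
Qed.

Lemma eq_unif_cvg F l l' : (forall s, 0 <= s <= u -> l s = l' s) ->
  unif_cvg F l -> unif_cvg F l'.
Proof.
move=> ll' Fl e /Fl[N H]; exists N => n Nn s s0u; rewrite -ll'//; exact: H.
Qed.

Lemma eq_unif_cvgl F F' l : (forall n s, 0 <= s <= u -> F n s = F' n s) ->
  unif_cvg F l -> unif_cvg F' l.
Proof.
move=> ll' Fl e /Fl[N H]; exists N => n Nn s s0u; rewrite -ll'//; exact: H.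
Qed.

Lemma unif_cvg_continuous F l : (forall n, {within `[0, u], continuous (F n)}) ->
  unif_cvg F l -> {within `[0, u], continuous l}.
Proof.
move=> cF Fl; apply/heine_cantor => e e0.
have e30 : 0 < e / 3 by rewrite divr_gt0.
have [N /(_ N (leqnn _)) H] := Fl _ e30.
have [del del0 H2] := (heine_cantor u (F N)).1 (cF N) _ e30.
exists del => // r s r0u s0u rs.
have -> : l r - l s = - (F N r - l r) + (F N r - F N s) + (F N s - l s).
  by rewrite opprB [l r - F N r + _]addrA subrK [RHS]addrA subrK.
rewrite (_ : e = e / 3 + e / 3 + e / 3); last by field.
rewrite (le_lt_trans (ler_normD _ _))// ltrD ?H//.
by rewrite (le_lt_trans (ler_normD _ _))// normrN ltrD ?H// H2.
Qed.

End uniform_convergence.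

Lemma unif_cvg_cauchy {R : realType} (u : R) (F : nat -> R -> R) :
  (exists l, unif_cvg u F l) <->
  (forall e : R, 0 < e -> exists N, forall m n, (N <= m)%N -> (N <= n)%N ->
     forall s, 0 <= s <= u -> `|F m s - F n s| <= e).
Proof.
split=> [[l Fl] e e0|Fc].
  have e20 : 0 < e / 2 by rewrite divr_gt0.
  have [N H] := Fl _ e20; exists N => m n Nm Nn s s0u.
  have -> : F m s - F n s = (F m s - l s) - (F n s - l s) by ring.
  by rewrite (le_trans (ler_normB _ _))// [leRHS]splitr lerD// ltW// H.
have cF s : 0 <= s <= u -> cvgn (F^~ s).
  move=> s0u; apply: cauchy_cvg; apply: cauchy_exP => e e0.
  have e20 : 0 < e / 2 by rewrite divr_gt0.
  have [N H] := Fc _ e20.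
  exists (F N s); exists N => // n /= Nn; rewrite -ball_normE /=.
  rewrite (le_lt_trans (H _ _ (leqnn _) Nn _ s0u))// ltr_pdivrMr// mulr2n; lra.
exists (fun s => limn (F^~ s)) => e e0.
have e20 : 0 < e / 2 by rewrite divr_gt0.
have [N H] := Fc _ e20; exists N => n Nn s s0u.
suff : `|F n s - limn (F^~ s)| <= e / 2.
  by move=> /le_lt_trans; apply; rewrite ltr_pdivrMr// mulr2n; lra.
have cv : `|F n s - F m s| @[m --> \oo] --> `|F n s - limn (F^~ s)|.
  by apply: cvg_norm; apply: cvgB; [exact: cvg_cst|exact: cF].
rewrite -(cvg_lim _ cv)//; apply: limr_le; first by apply/cvg_ex; eexists; exact: cv.
by exists N => // m /= Nm; exact: H.
Qed.

(** Time changes which are 1-Lipschitz from [0, v] to [0, u] preserve continuity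
of paths; stopping at a fixed time is the case of interest. *)
Lemma within_continuous_reparam {R : realType} {V : normedModType R} (u v : R)
    (phi : R -> R) (f : R -> V) :
  (forall r, 0 <= r <= v -> 0 <= phi r <= u) ->
  (forall r s, 0 <= r <= v -> 0 <= s <= v -> `|phi r - phi s| <= `|r - s|) ->
  {within `[0, u], continuous f} -> {within `[0, v], continuous (f \o phi)}.
Proof.
move=> phiu lip /heine_cantor cf; apply/heine_cantor => e /cf[del del0 H].
exists del => // r s r0v s0v rs; apply: H; [exact: phiu|exact: phiu|].
by rewrite (le_lt_trans _ rs)// lip.
Qed.

Lemma eq_within_continuous {R : realType} {V : normedModType R} (u : R)
    (f g : R -> V) :
  (forall r, 0 <= r <= u -> f r = g r) ->
  {within `[0, u], continuous f} -> {within `[0, u], continuous g}.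
Proof.
move=> fg /within_continuousP cf; apply/within_continuousP => r r0u e e0.
have [del del0 H] := cf r r0u e e0; exists del => // s s0u.
by rewrite -!fg//; exact: H.
Qed.

Lemma within_continuous_minr {R : realType} {V : normedModType R} (u c : R)
    (f : R -> V) : 0 <= c ->
  {within `[0, u], continuous f} ->
  {within `[0, u], continuous (fun s => f (Num.min s c))}.
Proof.
move=> c0; apply: within_continuous_reparam => [r|r s] H.
  by rewrite le_min ge_min c0 !andbT; case/andP: H => -> ->.
move=> _; rewrite /Order.min; case: ltP => ?; case: ltP => ? //.
- by rewrite !ler0_norm; lra.
- by rewrite !ger0_norm; lra.
- by rewrite subrr normr0.
Qed.

Section dyadic_grid.
Context {R : realType} (u : R).

(** The [k]-th point of the dyadic grid of [0, u] with [2 ^ N] cells. *)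
Definition dyadic (N k : nat) : R := u * k%:R / 2 ^+ N.

(** The index of the last grid point at or before [s]; when [u] is zero the division
yields the index 0, which is the right one for the only time 0. *)
Definition dyadic_floor (N : nat) (s : R) : nat := Num.truncn (s * 2 ^+ N / u).

Lemma dyadic0 N : dyadic N 0 = 0.
Proof. by rewrite /dyadic mulr0 mul0r. Qed.

Lemma dyadic_end N : dyadic N (2 ^ N) = u.
Proof. by rewrite /dyadic natrX mulfK// expf_neq0. Qed.

Hypothesis u_ge0 : 0 <= u.

Lemma dyadic_itv N k : (k <= 2 ^ N)%N -> 0 <= dyadic N k <= u.
Proof.
move=> kN; rewrite /dyadic divr_ge0 ?mulr_ge0 ?exprn_ge0//=.
by rewrite ler_pdivrMr ?exprn_gt0// ler_wpM2l// -natrX ler_nat.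
Qed.

Lemma dyadicS N k : dyadic N k.+1 = dyadic N k + u / 2 ^+ N.
Proof. by rewrite /dyadic -addn1 natrD mulrDr mulrDl mulr1. Qed.

Lemma ler_dyadic N k l : (k <= l)%N -> dyadic N k <= dyadic N l.
Proof.
by move=> kl; rewrite /dyadic ler_wpM2r ?invr_ge0 ?exprn_ge0// ler_wpM2l// ler_nat.
Qed.

Lemma dyadic_floor_le N s : 0 <= s <= u -> (dyadic_floor N s <= 2 ^ N)%N.
Proof.
move=> /andP[s0 su]; have [u0|u0] := eqVneq u 0.
  by rewrite /dyadic_floor u0 invr0 mulr0 truncn0.
have {}u0 : 0 < u by rewrite lt_neqAle eq_sym u0.
rewrite -(natrK (R := R) (2 ^ N)); apply: le_truncn.
by rewrite ler_pdivrMr// natrX mulrC ler_wpM2l ?exprn_ge0.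
Qed.

Lemma dyadic_floor_homo N r s : r <= s -> (dyadic_floor N r <= dyadic_floor N s)%N.
Proof.
move=> rs; apply: le_truncn; rewrite ler_wpM2r ?invr_ge0//.
by rewrite ler_wpM2r ?exprn_ge0.
Qed.

Lemma dyadic_floor_dist N s : 0 <= s <= u ->
  `|s - dyadic N (dyadic_floor N s)| <= u / 2 ^+ N.
Proof.
move=> /andP[s0 su]; have [uu0|u0] := eqVneq u 0.
  rewrite (_ : s = 0) ?uu0 /dyadic; last by apply/eqP; rewrite eq_le s0 -uu0 su.
  by rewrite uu0 !mul0r subrr normr0.
have {}u0 : 0 < u by rewrite lt_neqAle eq_sym u0.
have x0 : 0 <= s * 2 ^+ N / u by rewrite divr_ge0 ?mulr_ge0 ?exprn_ge0.
have /andP[] := truncn_itv x0; rewrite -/(dyadic_floor N s).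
have p0 : 0 < 2 ^+ N :> R by rewrite exprn_gt0.
set k := dyadic_floor N s.
rewrite ler_pdivlMr// ltr_pdivrMr// => H1 H2.
have A : dyadic N k <= s by rewrite /dyadic ler_pdivrMr// mulrC.
have B : s < dyadic N k + u / 2 ^+ N.
  by rewrite -dyadicS /dyadic ltr_pdivlMr// [ltRHS]mulrC.
by rewrite ger0_norm; lra.
Qed.

Lemma dyadic_mesh (e : R) : 0 < e ->
  exists N, forall n, (N <= n)%N -> u / 2 ^+ n < e.
Proof.
move=> e0; exists (Num.bound (u / e)) => n Nn.
have p0 : 0 < 2 ^+ n :> R by rewrite exprn_gt0.
rewrite ltr_pdivrMr// mulrC -ltr_pdivrMr//.
have /archi_boundP : 0 <= u / e by rewrite divr_ge0// ltW.
move=> /lt_le_trans; apply; rewrite -natrX ler_nat (leq_trans Nn)// ltnW//.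
exact: ltn_expl.
Qed.

Lemma dyadic_floor_cvg {V : normedModType R} (f : R -> V) s :
  {within `[0, u], continuous f} -> 0 <= s <= u ->
  f (dyadic N (dyadic_floor N s)) @[N --> \oo] --> f s.
Proof.
move=> /within_continuousP cf s0u; apply/cvgrPdist_lt => e e0.
have [del del0 H] := cf s s0u e e0.
have [N HN] := dyadic_mesh del0; exists N => // n /= Nn; apply: H.
  exact/dyadic_itv/dyadic_floor_le.
by rewrite (le_lt_trans (dyadic_floor_dist _ _))// HN.
Qed.

End dyadic_grid.

(** * Existence of Riemann-Stieltjes integrals *)

Section riemann_stieltjes.
Context {R : realType} (u : R).
Hypothesis u_ge0 : 0 <= u.
Implicit Types f g W F : R -> R.

(** The increments of [g] on [0, u] are dominated by those of [W]. For [g] of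
bounded variation, [W] is its variation function; for the identity, [W] is the
identity itself. *)
Definition increments_le g W := forall r s, 0 <= r -> r <= s -> s <= u ->
  `|g s - g r| <= W s - W r.

(** Over intervals shorter than [del], the increment of [F] agrees with [f dg]
at the left endpoint up to [e] times the increment of [W]. *)
Definition approx_primitive f g W F (e del : R) := forall r s,
  0 <= r -> r <= s -> s <= u -> s - r < del ->
  `|F s - F r - f r * (g s - g r)| <= e * (W s - W r).

(** [F] is an indefinite integral of [f] against [g], the error being measured
by [W]. *)
Definition primitive f g W F := forall e : R, 0 < e ->
  exists2 del : R, 0 < del & approx_primitive f g W F e del.

(** The left-point Riemann-Stieltjes sum of [f] against [g] over [0, s] along the
dyadic grid of [0, u]; stopping at [s] makes the cells after [s] vanish. *)
Definition dyadic_sum f g N s := \sum_(0 <= k < 2 ^ N)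
  f (dyadic u N k) *
  (g (Num.min s (dyadic u N k.+1)) - g (Num.min s (dyadic u N k))).

Lemma telescope_dyadic g N s : 0 <= s <= u ->
  \sum_(0 <= k < 2 ^ N)
    (g (Num.min s (dyadic u N k.+1)) - g (Num.min s (dyadic u N k))) = g s - g 0.
Proof.
move=> /andP[s0 su].
rewrite (telescope_sumr (fun k => g (Num.min s (dyadic u N k)))) //.
by rewrite dyadic0 dyadic_end min_l// min_r.
Qed.

(** The errors over the cells are added up by telescoping [W]. *)
Lemma dyadic_sum_approx f g W F e del N s : approx_primitive f g W F e del ->
  u / 2 ^+ N < del -> 0 <= s <= u ->
  `|dyadic_sum f g N s - (F s - F 0)| <= e * (W s - W 0).
Proof.
move=> FP mesh s0u; rewrite -(telescope_dyadic F N s0u) -(telescope_dyadic W N s0u).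
rewrite /dyadic_sum -sumrB mulr_sumr (le_trans (ler_norm_sum _ _ _))//.
rewrite !big_nat; apply: ler_sum => k /= kN.
have t0 := dyadic_itv u_ge0 (ltnW kN); have t1 := dyadic_itv u_ge0 kN.
have tS := dyadicS u N k; have tle := ler_dyadic u_ge0 N (leqnSn k).
set t := dyadic u N k in t0 tS tle *; set t' := dyadic u N k.+1 in t1 tS tle *.
case/andP: s0u => s0 su; have [st|ts] := leP s t.
  by rewrite (@min_l _ _ s t')// ?(le_trans st)// !subrr !mulr0 subrr normr0.
rewrite distrC; case/andP: t0 => t0 tu; case/andP: t1 => t10 t1u.
have [st'|ts'] := leP s t'.
  by apply: FP => //; lra.
by apply: FP => //; lra.
Qed.

(** A dyadic sum is itself an approximate primitive. Together with
[dyadic_sum_approx] this compares two dyadic sums without a common refinement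
of their grids. *)
Lemma approx_primitive_dyadic_sum f g W e del N : 0 <= e ->
  (forall r s, 0 <= r <= u -> 0 <= s <= u -> `|r - s| < del -> `|f r - f s| <= e) ->
  increments_le g W ->
  u / 2 ^+ N < del -> approx_primitive f g W (dyadic_sum f g N) e del.
Proof.
move=> e0 fe gW mesh a b a0 ab bu abdel.
have a0u : 0 <= a <= u by rewrite a0 (le_trans ab).
have b0u : 0 <= b <= u by rewrite bu (le_trans a0).
rewrite (_ : g b - g a = (g b - g 0) - (g a - g 0)); last by ring.
rewrite (_ : W b - W a = (W b - W 0) - (W a - W 0)); last by ring.
rewrite -(telescope_dyadic g N a0u) -(telescope_dyadic g N b0u).
rewrite -(telescope_dyadic W N a0u) -(telescope_dyadic W N b0u).
rewrite /dyadic_sum -!sumrB !mulr_sumr -!sumrB.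
rewrite (le_trans (ler_norm_sum _ _ _))// !big_nat; apply: ler_sum => k /= kN.
have t0 := dyadic_itv u_ge0 (ltnW kN); have t1 := dyadic_itv u_ge0 kN.
have tS := dyadicS u N k; have tle := ler_dyadic u_ge0 N (leqnSn k).
set t := dyadic u N k in t0 tS tle *; set t' := dyadic u N k.+1 in t1 tS tle *.
case/andP: (t0) => t00 tu; case/andP: (t1) => t10 t1u.
have [t'a|at'] := leP t' a.
  have ta : t <= a by rewrite (le_trans tle).
  rewrite !min_r ?(le_trans _ ab)//.
  by rewrite !(subrr, mulr0) normr0.
have [bt|tb] := leP b t.
  have bt' : b <= t' by rewrite (le_trans bt).
  by rewrite (min_l bt') (@min_l _ _ a t) ?(le_trans ab)//
    !(subrr, mulr0) normr0.
(* The cell meets [a, b]: its left endpoint is within [del] of [a]. *)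
have fte : `|f t - f a| <= e.
  apply: fe => //; rewrite ltr_norml; apply/andP; split; lra.
rewrite -mulrBr -mulrBl normrM ler_pM//.
have bt'b : Num.min b t' <= b by rewrite ge_min lexx.
have bt'a : a <= Num.min b t' by rewrite le_min ab ltW.
have bt't : t <= Num.min b t' by rewrite le_min tle ltW.
have le_u : Num.min b t' <= u by rewrite (le_trans bt'b).
set m := Num.min b t' in bt'b bt'a bt't le_u *.
have [ta|at_] := leP t a.
  rewrite !(_ : forall h : R -> R, h m - h t - (h a - h t) = h m - h a); last 2 first.
  - by move=> h; ring.
  - by move=> h; ring.
  exact: gW.
by rewrite !subrr !subr0; apply: gW => //; exact: ltW.
Qed.

(** The dyadic sums are uniformly Cauchy, and their limit is a primitive. *)
Lemma primitive_exists f g W : {within `[0, u], continuous f} ->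
  increments_le g W -> exists F, primitive f g W F.
Proof.
move=> /heine_cantor cf gW.
have W_homo r s : 0 <= r -> r <= s -> s <= u -> W r <= W s.
  by move=> r0 rs su; rewrite -subr_ge0 (le_trans _ (gW _ _ r0 rs su)).
(* One threshold [del] works for all fine enough grids at once. *)
have modulus (e : R) : 0 < e -> exists2 del : R, 0 < del & exists N0,
    forall N, (N0 <= N)%N -> u / 2 ^+ N < del /\
      approx_primitive f g W (dyadic_sum f g N) e del.
  move=> e0; have [del del0 H] := cf e e0.
  have [N0 HN] := dyadic_mesh u_ge0 del0; exists del => //; exists N0 => N /HN mesh.
  split=> //; apply: approx_primitive_dyadic_sum => //; first exact: ltW.
  by move=> r s r0u s0u rs; apply/ltW/H.
have dyadic_sum_at0 N : dyadic_sum f g N 0 = 0.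
  rewrite /dyadic_sum big_nat big1// => k /= kN.
  have /andP[t0 _] := dyadic_itv u_ge0 (ltnW kN).
  have /andP[t1 _] := dyadic_itv u_ge0 kN.
  by rewrite !min_l// subrr mulr0.
have [|F FP] := (unif_cvg_cauchy u (dyadic_sum f g)).2.
  move=> e e0; pose e' := e / (W u - W 0 + 1).
  have W0 : 0 <= W u - W 0 by rewrite subr_ge0 W_homo.
  have e'0 : 0 < e' by rewrite divr_gt0// ltr_wpDl.
  have [del del0 [N HN]] := modulus _ e'0; exists N => m n Nm Nn s s0u.
  have [mesh _] := HN _ Nm; have [_ app] := HN _ Nn.
  have := dyadic_sum_approx app mesh s0u.
  rewrite dyadic_sum_at0 subr0 => /le_trans; apply.
  have : W s <= W u by case/andP: s0u => *; apply: W_homo.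
  rewrite -(ler_pM2l e'0) => WW.
  have : e' * (W u - W 0) <= e.
    by rewrite /e' mulrAC ler_pdivrMr ?ltr_wpDl// ler_wpM2l ?ltW//; lra.
  by rewrite !mulrBr; lra.
(* Approximate primitives are stable under pointwise limits. *)
exists F => e e0; have [del del0 [N HN]] := modulus _ e0.
exists del => // r s r0 rs su rsd.
have r0u : 0 <= r <= u by rewrite r0 (le_trans rs).
have s0u : 0 <= s <= u by rewrite su (le_trans r0).
have cvF : dyadic_sum f g n s - dyadic_sum f g n r - f r * (g s - g r) @[n --> \oo]
    --> F s - F r - f r * (g s - g r).
  apply: cvgB; last exact: cvg_cst.
  by apply: cvgB; apply: unif_cvg_pointwise FP _ _.
move/cvg_norm in cvF; rewrite -(cvg_lim _ cvF)//; apply: limr_le.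
  by apply/cvg_ex; eexists; exact: cvF.
by exists N => // n /= /HN[_]; apply.
Qed.

Lemma primitive_unif_cvg f g W F :
  (forall r s, 0 <= r -> r <= s -> s <= u -> W r <= W s) ->
  primitive f g W F ->
  unif_cvg u (dyadic_sum f g) (fun s => F s - F 0).
Proof.
move=> W_homo FP e e0; pose e' := e / (W u - W 0 + 1).
have W0 : 0 <= W u - W 0 by rewrite subr_ge0 W_homo.
have e'0 : 0 < e' by rewrite divr_gt0// ltr_wpDl.
have [del del0 app] := FP _ e'0; have [N HN] := dyadic_mesh u_ge0 del0.
exists N => n /HN mesh s s0u.
rewrite (le_lt_trans (dyadic_sum_approx app mesh s0u))//.
have : W s <= W u by case/andP: s0u => *; apply: W_homo.
rewrite -(ler_pM2l e'0) => WW.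
have : e' * (W u - W 0) < e.
  by rewrite /e' mulrAC ltr_pdivrMr ?ltr_wpDl// ltr_pM2l//; lra.
by rewrite !mulrBr; lra.
Qed.

(** An increment of a primitive is the mesh-convergent integral: moving the tags
to the left endpoints costs a second error controlled by the modulus of
continuity of [f]. *)
Lemma primitive_RS_integral f g W F a b : {within `[0, u], continuous f} ->
  increments_le g W -> primitive f g W F -> 0 <= a -> a <= b -> b <= u ->
  is_RS_integral f g a b (F b - F a).
Proof.
move=> /heine_cantor cf gW FP a0 ab bu e e0; pose e' := e / (W b - W a + 1) / 2.
have W0 : 0 <= W b - W a by rewrite (le_trans _ (gW _ _ a0 ab bu)).
have e'0 : 0 < e' by rewrite !divr_gt0// ltr_wpDl.
have [del del0 app] := FP _ e'0; have [del' del'0 fe] := cf _ e'0.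
exists (Num.min del del'); first by rewrite lt_min del0.
move=> s xi ps xis.
pose p k := nth b (a :: s) k.
have tel (h : R -> R) : h b - h a = \sum_(0 <= k < size s) (h (p k.+1) - h (p k)).
  by rewrite (telescope_sumr (h \o p))// /p /= (itv_partition_nth_size _ ps).
rewrite (tel F) -sumrB (le_lt_trans (ler_norm_sum _ _ _))//.
apply: (@le_lt_trans _ _
  (\sum_(0 <= k < size s) 2 * e' * (W (p k.+1) - W (p k)))); last first.
  rewrite -mulr_sumr -(tel W) /e' (_ : 2 * _ = e / (W b - W a + 1)); last by field; lra.
  by rewrite mulrAC ltr_pdivrMr ?ltr_wpDl// ltr_pM2l//; lra.
rewrite !big_nat; apply: ler_sum => k /= ks.
have [/andP[pxi xip] +] := xis k ks; rewrite lt_min => /andP[mesh mesh'].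
have pa : a <= p k by apply: itv_partition_nth_ge ps; rewrite ltnS ltnW.
have pb : p k.+1 <= b by apply: itv_partition_nth_le ps.
rewrite -[nth b s k]/(p k.+1) -/(p k) in pxi xip mesh mesh'.
rewrite -[nth b s k]/(p k.+1) -/(p k).
move: pxi xip mesh mesh' pa pb; set r := p k; set r' := p k.+1.
move=> pxi xip mesh mesh' pa pb.
have pp : r <= r' by apply: le_trans xip.
rewrite (_ : _ - _ = (f (xi k) - f r) * (g r' - g r) -
  (F r' - F r - f r * (g r' - g r))); last by ring.
rewrite (le_trans (ler_normB _ _))//.
rewrite (_ : 2 * e' * _ = e' * (W r' - W r) + e' * (W r' - W r)); last by ring.
rewrite lerD//; last by apply: app => //; lra.
rewrite normrM ler_pM//; last by apply: gW => //; lra.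
by apply/ltW/fe; [lra|lra|]; rewrite ger0_norm; lra.
Qed.

End riemann_stieltjes.

(** Needed for the uniqueness of the mesh limit. *)
Lemma fine_partition_exists {R : realType} (a b del : R) : a <= b -> 0 < del ->
  exists2 s, itv_partition a b s &
    forall k, (k < size s)%N -> nth b s k - nth b (a :: s) k < del.
Proof.
move=> + del0; have [n bn] : exists n : nat, b - a < n%:R * (del / 2).
  exists (Num.bound (`|b - a| / (del / 2))).
  have d20 : 0 < del / 2 by rewrite divr_gt0.
  rewrite -ltr_pdivrMr//; apply: le_lt_trans (archi_boundP _).
    by rewrite ler_pM2r ?invr_gt0// ler_norm.
  by rewrite divr_ge0// ltW.
elim: n a bn => [a|n ih a bn ab].
  by rewrite mul0r => ba ab; exfalso; lra.
have [bad|bad] := ltP (b - a) del.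
  have [<-|ab'] := eqVneq a b; first by exists [::] => //; split.
  have {}ab : a < b by rewrite lt_neqAle ab'.
  by exists [:: b]; [exact: itv_partition1|case].
have [||s ps sdel] := ih (a + del / 2).
- by move: bn; rewrite -addn1 natrD mulrDl mul1r; lra.
- by lra.
exists (a + del / 2 :: s).
  by case: ps => ps ls; split => //=; rewrite ps andbT; lra.
by move=> [_ /=|k /= /sdel//]; lra.
Qed.

Lemma RS_integral_unique {R : realType} (f g : R -> R) a b v : a <= b ->
  is_RS_integral f g a b v -> RS_integral f g a b = v.
Proof.
move=> ab H; apply: get_unique => // w H'.
apply/eqP; rewrite -subr_eq0 -normr_le0 leNgt; apply/negP => d0.
have d20 : 0 < `|w - v| / 2 by rewrite divr_gt0.
have [del del0 Hdel] := H _ d20; have [del' del'0 Hdel'] := H' _ d20.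
have [|s ps sdel] := fine_partition_exists (del := Num.min del del') ab.
  by rewrite lt_min del0.
have tag k : (k < size s)%N ->
    nth b (a :: s) k <= nth b (a :: s) k <= nth b s k.
  rewrite lexx /= => ks; have := @nondecreasing_fun_itv_partition _ _ a b id s _ ps k ks.
  by apply.
set S := \sum_(0 <= k < size s)
  f (nth b (a :: s) k) * (g (nth b s k) - g (nth b (a :: s) k)).
have A : `|S - v| < `|w - v| / 2.
  apply: (Hdel s (nth b (a :: s))) => // k ks; split; first exact: tag.
  by have := sdel k ks; rewrite lt_min => /andP[].
have B : `|S - w| < `|w - v| / 2.
  apply: (Hdel' s (nth b (a :: s))) => // k ks; split; first exact: tag.
  by have := sdel k ks; rewrite lt_min => /andP[].
have : `|w - v| <= `|S - v| + `|S - w|.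
  by rewrite (_ : w - v = (S - v) - (S - w)) ?ler_normB//; ring.
by lra.
Qed.

(** * Lebesgue integrals as primitives, and bounded variation on dyadic grids *)

(** The Lebesgue integral of a continuous function is a primitive against the
identity, so that it shares the dyadic approximation of the Riemann-Stieltjes
integral. *)
Lemma lebesgue_primitive {R : realType} (u : R) (f : R -> R) : 0 <= u ->
  {within `[0, u], continuous f} ->
  primitive u f id id (fun s => \int[lebesgue_measure]_(r in `[0, s]) f r).
Proof.
move=> u0 cf e e0; have [del del0 H] := (heine_cantor _ _).1 cf _ e0.
exists del => // a b a0 ab bu abdel.
have intf c : c <= u -> lebesgue_measure.-integrable `[0, c] (EFin \o f).
  move=> cu; apply: continuous_compact_integrable; first exact: segment_compact.
  apply: continuous_subspaceW cf => r /=; rewrite !in_itv /= => /andP[-> /le_trans].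
  exact.
have intab : lebesgue_measure.-integrable `]a, b] (EFin \o f).
  apply: integrableS (intf b bu) => // r /=; rewrite !in_itv /= => /andP[ar ->].
  by rewrite (le_trans a0) ?ltW.
rewrite Rintegral_itvB ?bnd_simp//; last exact: intf.
have -> : f a * (b - a) = \int[lebesgue_measure]_(r in `]a, b]) (f a).
  rewrite Rintegral_cst//= lebesgue_measure_itv/= lte_fin.
  have [->|] := eqVneq a b; first by rewrite ltxx subrr.
  by move=> ab'; rewrite lt_neqAle ab' ab.
have intc c : lebesgue_measure.-integrable `]a, b] (EFin \o cst c).
  apply/integrableP; split; first by apply/measurable_EFinP; exact: measurable_cst.
  rewrite (_ : (fun x => _) = cst `|c|%:E) ?integral_cst//=.
  rewrite lebesgue_measure_itv/= lte_fin; case: ifP => _.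
    by rewrite -EFinM ltry.
  by rewrite mule0.
rewrite -RintegralB//; last exact: intc.
have intd : lebesgue_measure.-integrable `]a, b] (EFin \o (fun r => f r - f a)).
  exact: (integrableB _ intab (intc (f a))).
rewrite (le_trans (le_normr_Rintegral _ intd))//.
have -> : e * (b - a) = \int[lebesgue_measure]_(r in `]a, b]) e.
  rewrite Rintegral_cst//= lebesgue_measure_itv/= lte_fin.
  have [->|] := eqVneq a b; first by rewrite ltxx subrr.
  by move=> ab'; rewrite lt_neqAle ab' ab.
apply: le_Rintegral => //.
- exact: (integrable_norm intd).
- exact: intc.
move=> r /=; rewrite in_itv /= => /andP[ar rb]; rewrite distrC; apply/ltW/H.
- by rewrite a0 (le_trans ab).
- by rewrite (le_trans a0 (ltW ar)) (le_trans rb).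
- by rewrite ltr0_norm; lra.
Qed.

Lemma bounded_variation_increments_le {R : realType} (u : R) (g : R -> R) :
  bounded_variation 0 u g ->
  increments_le u g (fun s => fine (total_variation 0 s g)).
Proof.
move=> bv a b a0 ab bu.
have tv c : 0 <= c -> c <= u -> total_variation 0 c g \is a fin_num.
  move=> c0 cu; apply/(bounded_variationP g c0).
  by apply: (bounded_variationl c0 cu).
have tva := tv a a0 (le_trans ab bu); have tvb := tv b (le_trans a0 ab) bu.
rewrite -lee_fin EFinB !fineK// leeBrDr// addeC.
by rewrite (total_variationD g a0 ab) leeD2lE// total_variation_ge.
Qed.

(** The variation of [g] along a dyadic grid of [0, u]. *)
Definition dyadic_variation {R : realType} (u : R) (g : R -> R) (N : nat) :=
  \sum_(0 <= k < 2 ^ N) `|g (dyadic u N k.+1) - g (dyadic u N k)|.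

(** For a continuous function, rounding the points of an arbitrary partition down
to finer and finer grids bounds its variation by the dyadic variations. *)
Lemma bounded_variation_dyadicP {R : realType} (u : R) (g : R -> R) : 0 <= u ->
  {within `[0, u], continuous g} ->
  bounded_variation 0 u g <-> exists M : nat, forall N, dyadic_variation u g N <= M%:R.
Proof.
move=> u0 cg; split=> [bv|[M HM]].
  have gW := bounded_variation_increments_le bv.
  set W := (fun s => _) in gW.
  have W0 : 0 <= W u - W 0 by rewrite (le_trans _ (gW _ _ (lexx _) u0 (lexx _))).
  exists (Num.bound (W u - W 0)) => N.
  apply: le_trans (ltW (archi_boundP W0)).
  have -> : W u - W 0 = \sum_(0 <= k < 2 ^ N) (W (dyadic u N k.+1) - W (dyadic u N k)).
    by rewrite (telescope_sumr (fun k => W (dyadic u N k)))// dyadic0 dyadic_end.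
  rewrite /dyadic_variation !big_nat; apply: ler_sum => k /= kN.
  have /andP[t0 _] := dyadic_itv u0 (ltnW kN).
  have /andP[_ t1] := dyadic_itv u0 kN.
  by apply: gW => //; exact: ler_dyadic.
exists M%:R => _ [s ps <-].
pose p := nth 0 (0 :: s).
have pE k : (k <= size s)%N -> nth u (0 :: s) k = p k.
  by move=> ks; apply: set_nth_default; rewrite /= ltnS.
have pu k : (k <= size s)%N -> 0 <= p k <= u.
  move=> ks; rewrite -pE// (itv_partition_nth_ge _ ps) ?ltnS//.
  by rewrite (itv_partition_nth_le _ ps) ?ltnS.
have pS k : (k < size s)%N -> p k <= p k.+1.
  move=> ks; rewrite -(pE k (ltnW ks)) -(pE k.+1 ks).
  by have := @nondecreasing_fun_itv_partition _ _ 0 u id s _ ps k ks; apply.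
(* Round the partition points down to the grid of level [N]. *)
pose q N k := dyadic_floor u N (p k).
have qS N k : (k < size s)%N -> (q N k <= q N k.+1)%N.
  by move=> ks; apply: dyadic_floor_homo => //; exact: pS.
have cvg_var : \sum_(0 <= k < size s)
      `|g (dyadic u N (q N k.+1)) - g (dyadic u N (q N k))|
    @[N --> \oo] --> variation 0 u g s.
  rewrite /variation /= big_nat; under eq_fun do rewrite big_nat.
  apply: cvg_big => //; first exact: add_continuous.
  move=> k /= ks; rewrite -[nth u s k]/(nth u (0 :: s) k.+1).
  rewrite (pE k.+1 ks) (pE k (ltnW ks)).
  apply: cvg_norm; apply: cvgB; apply: dyadic_floor_cvg => //; apply: pu => //.
  exact: ltnW.
rewrite -(cvg_lim _ cvg_var)//; apply: limr_le.
  by apply/cvg_ex; eexists; exact: cvg_var.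
apply: nearW => N; apply: le_trans (HM N).
pose Z m := \sum_(0 <= k < m) `|g (dyadic u N k.+1) - g (dyadic u N k)|.
have Zd k l : (k <= l)%N -> `|g (dyadic u N l) - g (dyadic u N k)| <= Z l - Z k.
  move=> kl; rewrite /Z (@big_cat_nat _ _ _ k 0 l)//= addrAC subrr add0r.
  by rewrite -(telescope_sumr (fun k => g (dyadic u N k)) kl) ler_norm_sum.
apply: (@le_trans _ _ (\sum_(0 <= k < size s) (Z (q N k.+1) - Z (q N k)))).
  by rewrite !big_nat; apply: ler_sum => k /= ks; exact/Zd/qS.
rewrite (telescope_sumr (fun k => Z (q N k)))//.
have Z_homo k l : (k <= l)%N -> Z k <= Z l.
  by move=> kl; rewrite -subr_ge0 (le_trans _ (Zd _ _ kl)).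
apply: (@le_trans _ _ (Z (2 ^ N)%N)).
  rewrite lerBlDr (le_trans (Z_homo _ (2 ^ N)%N _)) ?lerDl ?sumr_ge0//.
  by apply: dyadic_floor_le => //; exact: pu.
by [].
Qed.

(** * Measurable processes with continuous paths *)

Section measurable_processes.
Context {d : measure_display} {Om : measurableType d} {R : realType}.
Variable u : R.
Hypothesis u_ge0 : 0 <= u.
Implicit Types (D : set Om) (Z : Om -> R -> R).

(** Processes with continuous paths on [0, u], measurable on [D] at each time. The
restriction to a domain [D] is essential: the endogenous integral has no
meaning outside of the set where its approximations converge. *)
Definition mproc D Z :=
  (forall s, 0 <= s <= u -> measurable_fun D (Z^~ s)) /\
  (forall w, D w -> {within `[0, u], continuous (Z w)}).

Lemma mproc_subset D D' Z : measurable D -> D' `<=` D -> mproc D Z -> mproc D' Z.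
Proof.
move=> mD DD' [mZ cZ]; split=> [s s0u|w /DD']; last exact: cZ.
exact: measurable_funS mD DD' (mZ s s0u).
Qed.

Lemma eq_mproc D Z Z' : (forall w s, D w -> 0 <= s <= u -> Z w s = Z' w s) ->
  mproc D Z -> mproc D Z'.
Proof.
move=> ZZ' [mZ cZ]; split=> [s s0u|w Dw].
  apply: eq_measurable_fun (mZ s s0u) => w; rewrite inE => Dw; exact: ZZ'.
by apply: eq_within_continuous (cZ w Dw) => r r0u; exact: ZZ'.
Qed.

Lemma mproc_time_cst D (X : Om -> R) : measurable_fun D X -> mproc D (fun w _ => X w).
Proof. by move=> mX; split=> // w _ s; exact: cvg_cst. Qed.

Lemma mprocD D Z Z' : mproc D Z -> mproc D Z' -> mproc D (fun w s => Z w s + Z' w s).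
Proof.
move=> [mZ cZ] [mZ' cZ']; split=> [s s0u|w Dw].
  by apply: measurable_funD; [exact: mZ|exact: mZ'].
by move=> r; apply: continuousD; [exact: cZ|exact: cZ'].
Qed.

Lemma mprocM D Z Z' : mproc D Z -> mproc D Z' -> mproc D (fun w s => Z w s * Z' w s).
Proof.
move=> [mZ cZ] [mZ' cZ']; split=> [s s0u|w Dw].
  by apply: measurable_funM; [exact: mZ|exact: mZ'].
by move=> r; apply: continuousM; [exact: cZ|exact: cZ'].
Qed.

Lemma mprocB D Z Z' : mproc D Z -> mproc D Z' -> mproc D (fun w s => Z w s - Z' w s).
Proof.
move=> [mZ cZ] [mZ' cZ']; split=> [s s0u|w Dw].
  by apply: measurable_funB; [exact: mZ|exact: mZ'].
by move=> r; apply: continuousB; [exact: cZ|exact: cZ'].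
Qed.

Lemma mproc_norm D Z : mproc D Z -> mproc D (fun w s => `|Z w s|).
Proof.
move=> [mZ cZ]; split=> [s s0u|w Dw].
  by apply: measurableT_comp => //; exact: mZ.
by move=> r; apply: continuous_comp; [exact: cZ|exact: norm_continuous].
Qed.

Lemma mproc_sum D (I : Type) (s : seq I) (Z : I -> Om -> R -> R) :
  (forall i, mproc D (Z i)) -> mproc D (fun w r => \sum_(i <- s) Z i w r).
Proof.
move=> mZ; elim: s => [|i s ih].
  apply: (@eq_mproc _ (fun _ _ => 0)); first by move=> *; rewrite big_nil.
  exact/mproc_time_cst/measurable_cst.
apply: (eq_mproc _ (mprocD (mZ i) ih)) => w r _ _; by rewrite big_cons.
Qed.

(** Evaluation at a random time: round the time down to the dyadic grid, where the
process takes countably many measurable values, and pass to the limit. *)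
Lemma measurable_mproc_at D Z (tau : Om -> R) : measurable D -> mproc D Z ->
  measurable_fun D tau -> (forall w, D w -> 0 <= tau w <= u) ->
  measurable_fun D (fun w => Z w (tau w)).
Proof.
move=> mD [mZ cZ] mtau tau0u.
apply: (measurable_fun_cvg
  (h := fun N w => Z w (dyadic u N (dyadic_floor u N (tau w))))); last first.
  by move=> w Dw; apply: dyadic_floor_cvg => //; [exact: cZ|exact: tau0u].
move=> N; pose q w := (dyadic_floor u N (tau w)).
(* Truncation sends negative numbers to 0, hence the second disjunct below. *)
have mq k : measurable (D `&` [set w | q w = k]).
  have -> : D `&` [set w | q w = k] = D `&` tau @^-1` [set s | dyadic_floor u N s = k].
    by [].
  apply: mtau => //.
  rewrite (_ : [set _ | _] = [set s | (k%:R <= s * 2 ^+ N / u < k.+1%:R)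
      || ((k == 0%N) && (s * 2 ^+ N / u < 0))]).
    have mf : measurable_fun setT (fun s : R => s * 2 ^+ N / u).
      apply: measurable_funM; last exact: measurable_cst.
      by apply: measurable_funM; [exact: measurable_id|exact: measurable_cst].
    have mb : measurable_fun setT (fun s : R => (k%:R <= s * 2 ^+ N / u < k.+1%:R)
      || ((k == 0%N) && (s * 2 ^+ N / u < 0))).
      apply: measurable_or; apply: measurable_and.
      - by apply: measurable_fun_ler => //; exact: measurable_cst.
      - by apply: measurable_fun_ltr => //; exact: measurable_cst.
      - exact: measurable_cst.
      - by apply: measurable_fun_ltr => //; exact: measurable_cst.
    by have := mb measurableT [set true] I; rewrite setTI.
  apply/seteqP; split=> s /=; rewrite /dyadic_floor.
    have [s0|s0] := leP 0 (s * 2 ^+ N / u).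
      by move/eqP; rewrite truncn_eq// => ->.
    rewrite truncn_floor leNgt s0 /= => <-; by rewrite eqxx orbT.
  case/orP => [H|/andP[/eqP-> H]]; first exact: truncn_def.
  by rewrite truncn_floor leNgt H.
have DE : D = \bigcup_k (D `&` [set w | q w = k]).
  apply/seteqP; split=> [w Dw|w [k _ []//]]; by exists (q w).
rewrite {1}DE; apply/measurable_fun_bigcup => // k.
have [kN|kN] := leqP k (2 ^ N).
  apply: (eq_measurable_fun (fun w => Z w (dyadic u N k))).
    by move=> w; rewrite inE => -[_ <-].
  apply: measurable_funS mD _ (mZ _ _); first exact: subIsetl.
  exact: dyadic_itv.
rewrite (_ : _ `&` _ = set0); first exact: measurable_fun_set0.
apply/seteqP; split=> // w [Dw /= qk]; move: kN; rewrite ltnNge -qk => /negP; apply.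
exact/dyadic_floor_le/tau0u.
Qed.

Lemma mproc_stopped D Z (tau : Om -> R) : measurable D -> mproc D Z ->
  measurable_fun D tau -> (forall w, D w -> 0 <= tau w <= u) ->
  mproc D (fun w s => Z w (Num.min s (tau w))).
Proof.
move=> mD mZ mtau tau0u; split=> [s /andP[s0 su]|w Dw].
  apply: (measurable_mproc_at (tau := fun w => Num.min s (tau w))) => //.
    by apply: measurable_minr => //; exact: measurable_cst.
  by move=> w /tau0u /andP[t0 _]; rewrite le_min s0 t0 ge_min su.
apply: within_continuous_minr; first by have /andP[] := tau0u _ Dw.
by have [_] := mZ; apply.
Qed.

Lemma measurable_mproc_le D Z (c : R) : measurable D -> mproc D Z ->
  measurable [set w | D w /\ forall s, 0 <= s <= u -> Z w s <= c].
Proof.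
move=> mD [mZ cZ].
rewrite (_ : [set _ | _] = D `&` \bigcap_N \bigcap_(k in [set k | (k <= 2 ^ N)%N])
  (D `&` [set w | Z w (dyadic u N k) <= c])).
  apply: measurableI => //; apply: bigcapT_measurable => N.
  apply: bigcap_measurable; first by exists 0%N.
  move=> k /= kN; have mZk := mZ _ (dyadic_itv u_ge0 kN).
  rewrite -[X in measurable (D `&` X)]/((Z^~ (dyadic u N k)) @^-1` [set r | r <= c]).
  by apply: mZk => //; rewrite -[X in measurable X]set_itvNyc; exact: measurable_itv.
apply/seteqP; split=> w [Dw H]; split=> //.
  by move=> N _ k /= kN; split => //; apply: H; exact: dyadic_itv.
move=> s s0u; have cvgs := dyadic_floor_cvg u_ge0 (cZ w Dw) s0u.
rewrite -(cvg_lim _ cvgs)//; apply: limr_le.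
  by apply/cvg_ex; eexists; exact: cvgs.
apply: nearW => N; have [] // := H N I (dyadic_floor u N s).
exact: dyadic_floor_le.
Qed.

Lemma measurable_mproc_unif_cvg D (Z : nat -> Om -> R -> R) : measurable D ->
  (forall n, mproc D (Z n)) ->
  measurable [set w | D w /\ exists l, unif_cvg u (Z^~ w) l].
Proof.
move=> mD mZ.
rewrite (_ : [set _ | _] = D `&` \bigcap_p \bigcup_N
  \bigcap_(m in [set m | (N <= m)%N]) \bigcap_(n in [set n | (N <= n)%N])
  [set w | D w /\ forall s, 0 <= s <= u -> `|Z m w s - Z n w s| <= p.+1%:R^-1]).
  apply: measurableI => //; apply: bigcapT_measurable => p.
  apply: bigcup_measurable => N _; apply: bigcap_measurable; first by exists N => /=.
  move=> m _; apply: bigcap_measurable; first by exists N => /=.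
  by move=> n _; apply: measurable_mproc_le => //; apply/mproc_norm/mprocB.
apply/seteqP; split=> w [Dw H]; split=> //.
  move=> p _; have [|N HN] := (unif_cvg_cauchy _ _).1 H p.+1%:R^-1.
    by rewrite invr_gt0.
  by exists N => // m /= Nm n /= Nn; split=> // s; exact: HN.
apply/unif_cvg_cauchy => e e0; have [p pe] : exists p, p.+1%:R^-1 < e.
  exists (Num.bound e^-1); rewrite invf_plt ?posrE//.
  by rewrite (lt_trans (archi_boundP _)) ?ltr_nat// invr_ge0 ltW.
have [N _ HN] := H p I; exists N => m n Nm Nn s s0u.
by apply: le_trans (ltW pe); have [_] := HN m Nm n Nn; apply.
Qed.

Lemma mproc_unif_lim D (Z : nat -> Om -> R -> R) (L : Om -> R -> R) :
  (forall n, mproc D (Z n)) ->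
  (forall w, D w -> unif_cvg u (Z^~ w) (L w)) -> mproc D L.
Proof.
move=> mZ ZL; split=> [s s0u|w Dw].
  apply: (measurable_fun_cvg (h := fun n w => Z n w s)).
    by move=> n; have [+ _] := mZ n; apply.
  by move=> w Dw; apply: (unif_cvg_pointwise (ZL w Dw)).
apply: unif_cvg_continuous (ZL w Dw) => n.
by have [_] := mZ n; apply.
Qed.

Lemma measurable_mproc_bounded_variation D Z : measurable D -> mproc D Z ->
  measurable [set w | D w /\ bounded_variation 0 u (Z w)].
Proof.
move=> mD mZ; have [mZs cZ] := mZ.
rewrite (_ : [set _ | _] = D `&` \bigcup_M \bigcap_N
  (D `&` [set w | dyadic_variation u (Z w) N <= M%:R])).
  apply: measurableI => //; apply: bigcupT_measurable => M.
  apply: bigcapT_measurable => N.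
  have mV : measurable_fun D (fun w => dyadic_variation u (Z w) N).
    under eq_fun do rewrite /dyadic_variation big_mkord.
    apply: measurable_sum => k; apply: measurableT_comp => //.
    by apply: measurable_funB; apply: mZs; apply: dyadic_itv => //; exact: ltnW.
  rewrite -[X in measurable (D `&` X)]/(
    (fun w => dyadic_variation u (Z w) N) @^-1` [set r | r <= M%:R]).
  by apply: mV => //; rewrite -[X in measurable X]set_itvNyc; exact: measurable_itv.
apply/seteqP; split=> w [Dw H]; split=> //.
  have [M HM] := (bounded_variation_dyadicP u_ge0 (cZ w Dw)).1 H.
  by exists M => // N _; split=> //=.
apply/bounded_variation_dyadicP => //; first exact: cZ.
by have [M _ HM] := H; exists M => N; have [_] := HM N I.
Qed.

Lemma mproc_dyadic_sum D (Z G : Om -> R -> R) N : measurable D ->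
  mproc D Z -> mproc D G -> mproc D (fun w s => dyadic_sum u (Z w) (G w) N s).
Proof.
move=> mD mZ mG; apply: (@eq_mproc _ (fun w s => \sum_(k < 2 ^ N)
  Z w (dyadic u N k) *
  (G w (Num.min s (dyadic u N k.+1)) - G w (Num.min s (dyadic u N k))))).
  by move=> w s _ _; rewrite /dyadic_sum big_mkord.
apply: mproc_sum => k; apply: mprocM.
  apply: mproc_time_cst; have [+ _] := mZ; apply; apply: dyadic_itv => //; exact: ltnW.
have stop l : (l <= 2 ^ N)%N -> mproc D (fun w s => G w (Num.min s (dyadic u N l))).
  move=> lN; apply: (mproc_stopped (tau := fun _ => dyadic u N l)) => //.
  by move=> w _; exact: dyadic_itv.
by apply: mprocB; apply: stop => //; exact: ltnW.
Qed.

Lemma mproc_RS_integral D (Z G : Om -> R -> R) : measurable D ->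
  mproc D Z -> mproc D G -> (forall w, D w -> bounded_variation 0 u (G w)) ->
  mproc D (fun w s => RS_integral (Z w) (G w) 0 s).
Proof.
move=> mD mZ mG bv.
apply: (mproc_unif_lim (Z := fun N w s => dyadic_sum u (Z w) (G w) N s)).
  by move=> N; exact: mproc_dyadic_sum.
move=> w Dw; have cZ : {within `[0, u], continuous (Z w)} by have [_] := mZ; apply.
have gW := bounded_variation_increments_le (bv w Dw).
have [F FP] := primitive_exists u_ge0 cZ gW.
apply: eq_unif_cvg (primitive_unif_cvg u_ge0 _ FP) => [s /andP[s0 su]|r s r0 rs su].
  symmetry; apply: RS_integral_unique => //.
  exact: primitive_RS_integral FP _ _ _.
by rewrite -subr_ge0 (le_trans _ (gW _ _ r0 rs su)).
Qed.

Lemma mproc_Rintegral D (Z : Om -> R -> R) : measurable D -> mproc D Z ->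
  mproc D (fun w s => \int[lebesgue_measure]_(r in `[0, s]) Z w r).
Proof.
move=> mD mZ.
apply: (mproc_unif_lim (Z := fun N w s => dyadic_sum u (Z w) id N s)).
  move=> N; apply: (mproc_dyadic_sum (G := fun _ => id)) => //; split=> [s _|w _].
    exact: measurable_cst.
  by apply: continuous_subspaceT => r; exact: cvg_id.
move=> w Dw; have cZ : {within `[0, u], continuous (Z w)} by have [_] := mZ; apply.
apply: eq_unif_cvg (primitive_unif_cvg u_ge0 _ (lebesgue_primitive u_ge0 cZ)) => //.
by move=> s _; rewrite set_itv1 Rintegral_set1 subr0.
Qed.

End measurable_processes.

(** * Stopping times along a continuous integrand *)

Section stopping_times.
Context {R : realType} (u : R) (m d : nat).
Hypothesis u_ge0 : 0 <= u.
Implicit Types (h : R -> 'M[R]_(m, d)).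
Local Open Scope ereal_scope.

Let crossing h n k := [set s : R | (tau u h n k < s <= u)%R /\
  (2 ^- n < frobenius (h s - h (tau u h n k)))%R].

(** The value [fine] of the minimum loses nothing: the minimum is finite even when
the threshold is never crossed and the infimum is infinite. *)
Lemma tau_fin h n k : (0 <= tau u h n k <= u)%R ->
  (tau u h n k.+1)%:E = Order.min (ereal_inf [set s%:E | s in crossing h n k]) u%:E.
Proof.
move=> /andP[t0 tu]; rewrite [tau u h n k.+1]/= -/(crossing h n k) fineK//.
rewrite fin_numE; apply/andP; split.
  rewrite gt_eqF// lt_min ltNyr andbT (lt_le_trans (ltNyr 0))//.
  apply: le_ereal_inf_tmp => _ [s [/andP[ts _] _] <-].
  by rewrite lee_fin (le_trans t0) ?ltW.
by rewrite lt_eqF// gt_min ltry orbT.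
Qed.

Lemma tau_itv h n k : (0 <= tau u h n k <= u)%R.
Proof.
elim: k => [|k ih]; first by rewrite /= lexx.
rewrite -!lee_fin (tau_fin ih) le_min ge_min lee_fin u_ge0 lexx orbT !andbT.
apply: le_ereal_inf_tmp => _ [s [/andP[ts _] _] <-].
by rewrite lee_fin (le_trans _ (ltW ts))//; case/andP: ih.
Qed.

Lemma tau_le h n k : (tau u h n k <= tau u h n k.+1)%R.
Proof.
rewrite -lee_fin (tau_fin (tau_itv _ _ _)) le_min lee_fin.
have /andP[_ ->] := tau_itv h n k; rewrite andbT.
apply: le_ereal_inf_tmp => _ [s [/andP[ts _] _] <-].
by rewrite lee_fin ltW.
Qed.

(** The next stopping time comes before [a] exactly when the threshold is crossed
at some time strictly before [a]. *)
Lemma tau_ltP h n k (a : R) : (a <= u)%R -> (tau u h n k.+1 < a)%R <->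
  exists s, [/\ (tau u h n k < s)%R, (s < a)%R &
    (2 ^- n < frobenius (h s - h (tau u h n k)))%R].
Proof.
move=> au; have ua : (u%:E < a%:E) = false by rewrite lte_fin ltNge au.
rewrite -lte_fin (tau_fin (tau_itv _ _ _)) gt_min ua orbF.
split=> [/ereal_inf_lt[_ [s [/andP[ts _] fs] <-]]|[s [ts sa fs]]].
  by rewrite lte_fin => sa; exists s.
apply: le_lt_trans (_ : _ <= s%:E) _; last by rewrite lte_fin.
apply: ereal_inf_lbound; exists s => //; split=> //.
by rewrite ts (le_trans (ltW sa)).
Qed.

End stopping_times.

Section frobenius_norm.
Context {R : realType} (m d : nat).
Implicit Types A B : 'M[R]_(m, d).

Lemma mx_norm_ltP A (e : R) : 0 < e -> `|A| < e <-> forall i j, `|A i j| < e.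
Proof.
move=> e0; rewrite -[`|A|]/(mx_norm A) mx_normrE; split.
  by move=> /bigmax_ltP[_ H] i j; exact: (H (i, j)).
by move=> H; apply/bigmax_ltP; split=> // -[i j] _; exact: H.
Qed.

Lemma frobenius_le A (e : R) : 0 <= e -> (forall i j, `|A i j| <= e / (m * d).+1%:R) ->
  frobenius A <= e.
Proof.
move=> e0 Ae; rewrite /frobenius -[leRHS](ger0_norm e0) -sqrtr_sqr.
set c := e / _ in Ae; have c0 : 0 <= c by rewrite divr_ge0.
have ec : e = c * (m * d).+1%:R by rewrite divfK.
apply: ler_wsqrtr; apply: (@le_trans _ _ (\sum_(i < m) \sum_(j < d) c ^+ 2)).
  apply: ler_sum => i _; apply: ler_sum => j _.
  by rewrite -real_normK ?num_real// ler_sqr ?nnegrE.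
rewrite !sumr_const !card_ord -mulrnA mulnC -[_ *+ (m * d)]mulr_natr ec [leRHS]exprMn.
rewrite ler_wpM2l ?exprn_ge0//.
rewrite -natrX ler_nat (leq_trans (leqnSn _))// -[leqLHS]expn1 leq_pexp2l//.
Qed.

End frobenius_norm.

Section stopped_sums.
Context {R : realType} (u : R) (m d : nat).
Hypothesis u_ge0 : 0 <= u.
Implicit Types (h : R -> 'M[R]_(m, d)).

Lemma frobenius_continuous h r : {within `[0, u], continuous h} ->
  {within `[0, u], continuous (fun s => frobenius (h s - h r))}.
Proof.
move=> ch s; apply: (@continuous_comp _ _ _ (fun s : subspace `[0, u] =>
  \sum_i \sum_j (h s - h r) i j ^+ 2) Num.sqrt); last first.
  exact: sqrt_continuous.
apply: cvg_big => // [|i _]; first exact: add_continuous.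
apply: cvg_big => // [|j _]; first exact: add_continuous.
apply: (@continuous_comp (subspace `[0, u]) _ _ (fun s => (h s - h r) i j)
  (fun x : R => x ^+ 2)); last first.
  exact: exprn_continuous.
apply: (@continuous_comp (subspace `[0, u]) _ _ (fun s => h s - h r)
  (fun M : 'M[R]_(m, d) => M i j)); last first.
  exact: coord_continuous.
by have := cvgB (ch s) (cvg_cst (h r)); apply.
Qed.

(** Between two consecutive stopping times, a continuous integrand must vary by
[2 ^- n], which takes a time bounded below by uniform continuity. *)
Lemma tau_end h n : {within `[0, u], continuous h} ->
  exists K, forall k, (K <= k)%N -> tau u h n k = u.
Proof.
move=> /heine_cantor ch; have p0 : 0 < 2 ^- n / (m * d).+1%:R :> R by rewrite divr_gt0.
have [del del0 H] := ch _ p0.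
(* Each step lasts at least [del], unless the horizon comes first. *)
have step k : Num.min u (k%:R * del) <= tau u h n k.
  elim: k => [|k ih]; first by rewrite mul0r min_r.
  rewrite leNgt; apply/negP.
  have au : Num.min u (k.+1%:R * del) <= u by rewrite ge_min lexx.
  move=> /(tau_ltP u_ge0 _ _ _ au)[s [ts + fs]]; rewrite lt_min => /andP[su sk].
  have /andP[t0 tu] := tau_itv u_ge0 h n k.
  have tk : k%:R * del <= tau u h n k.
    move: ih; rewrite ge_min => /orP[ut|//].
    by have := lt_trans su (le_lt_trans ut ts); rewrite ltxx.
  move: fs; rewrite ltNge => /negP; apply; apply: frobenius_le => // i j.
  apply/ltW; move: i j; apply/mx_norm_ltP => //; apply: H.
  - by rewrite (le_trans t0 (ltW ts)) ltW.
  - by rewrite t0.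
  - by move: sk; rewrite -addn1 natrD mulrDl mul1r => sk; rewrite ger0_norm; lra.
exists (Num.bound (u / del)) => k Kk; have /andP[t0 tu] := tau_itv u_ge0 h n k.
apply/eqP; rewrite eq_le tu /= (le_trans _ (step k))// le_min lexx /=.
rewrite -ler_pdivrMr//; apply: ltW; apply: lt_le_trans (archi_boundP _) _.
  by rewrite divr_ge0// ltW.
by rewrite ler_nat.
Qed.

End stopped_sums.

(** * Measurability of the endogenous integral *)

Lemma coordwise_unif_cvg {R : realType} (u : R) (m d : nat)
    (F : nat -> R -> 'M[R]_(m, d)) (l : R -> 'M[R]_(m, d)) :
  unif_cvg u F l <->
  forall i j, unif_cvg u (fun n s => F n s i j) (fun s => l s i j).
Proof.
split=> [Fl i j e e0|Fl e e0].
  have [N HN] := Fl e e0; exists N => n Nn s s0u.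
  by have /(mx_norm_ltP _ e0)/(_ i j) := HN n Nn s s0u; rewrite !mxE.
have /choice[f Hf] : forall ij : 'I_m * 'I_d, exists N, forall n, (N <= n)%N ->
    forall s, 0 <= s <= u -> `|F n s ij.1 ij.2 - l s ij.1 ij.2| < e.
  by move=> ij; exact: Fl.
exists (\max_ij f ij)%N => n Nn s s0u; apply/(mx_norm_ltP _ e0) => i j.
rewrite !mxE; apply: (Hf (i, j)) => //.
by apply: leq_trans Nn; exact: (leq_bigmax (i, j)).
Qed.

Section measurable_endogenous_sums.
Context {dd : measure_display} {Om : measurableType dd} {R : realType}.
Variable u : R.
Hypothesis u_ge0 : 0 <= u.
Variables (m d : nat) (D : set Om).
Hypothesis mD : measurable D.

(** The matrix-valued analogue of [mproc], on the fixed domain [D]. *)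
Definition mxproc (p q : nat) (H : Om -> R -> 'M[R]_(p, q)) :=
  (forall s, 0 <= s <= u -> forall i j, measurable_fun D (fun w => H w s i j)) /\
  (forall w, D w -> {within `[0, u], continuous (H w)}).

Lemma mxproc_coord p q (H : Om -> R -> 'M[R]_(p, q)) i j :
  mxproc H -> mproc u D (fun w s => H w s i j).
Proof.
move=> [mH cH]; split=> [s s0u|w Dw s]; first exact: mH.
apply: (@continuous_comp (subspace `[0, u]) _ _ (H w)
  (fun M : 'M[R]_(p, q) => M i j)); first exact: cH.
exact: coord_continuous.
Qed.

Lemma measurable_fun_lt (f : Om -> R) :
  (forall a, measurable (D `&` [set w | f w < a])) -> measurable_fun D f.
Proof.
move=> mf _; apply: (measurability _ (RGenInftyO.measurableE R)) => //.
move=> _ [_ [a ->] <-]; rewrite set_itvNyo; exact: mf.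
Qed.

Variable H : Om -> R -> 'M[R]_(m, d).
Hypothesis mxH : mxproc H.

Lemma mproc_frobenius (tau : Om -> R) : measurable_fun D tau ->
  (forall w, D w -> 0 <= tau w <= u) ->
  mproc u D (fun w s => frobenius (H w s - H w (tau w))).
Proof.
move=> mtau tau0u; split=> [s s0u|w Dw].
  apply: measurableT_comp.
    by apply: continuous_measurable_fun; exact: sqrt_continuous.
  apply: measurable_sum => i; apply: measurable_sum => j.
  apply: measurable_funX.
  apply: (eq_measurable_fun (fun w => H w s i j - H w (tau w) i j)).
    by move=> w _; rewrite !mxE.
  have mHij := mxproc_coord i j mxH; apply: measurable_funB.
    by have [+ _] := mHij; apply.
  exact: measurable_mproc_at mHij _ _.
by apply: frobenius_continuous; have [_] := mxH; apply.
Qed.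

(** The conditions of [tau_ltP] are open in the crossing time, which can therefore
be taken on a dyadic grid. *)
Lemma measurable_tau n k : measurable_fun D (fun w => tau u (H w) n k).
Proof.
elim: k => [|k ih]; first exact: measurable_cst.
apply: measurable_fun_lt => a.
have mF := mproc_frobenius ih (fun w _ => tau_itv u_ge0 (H w) n k).
have [au|ua] := leP a u; last first.
  rewrite (_ : _ `&` _ = D)//; apply/seteqP; split=> [w []//|w Dw]; split=> //=.
  by have /andP[_ /le_lt_trans] := tau_itv u_ge0 (H w) n k.+1; apply.
rewrite (_ : _ `&` _ = \bigcup_N \bigcup_(l in [set l | (l <= 2 ^ N)%N])
  (D `&` [set w | [&& tau u (H w) n k < dyadic u N l, dyadic u N l < a &
    2 ^- n < frobenius (H w (dyadic u N l) - H w (tau u (H w) n k))]])).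
  apply: bigcupT_measurable => N; apply: bigcup_measurable => l /= lN.
  have mb : measurable_fun D (fun w =>
    [&& tau u (H w) n k < dyadic u N l, dyadic u N l < a &
    2 ^- n < frobenius (H w (dyadic u N l) - H w (tau u (H w) n k))]).
    apply: measurable_and.
      by apply: measurable_fun_ltr => //; exact: measurable_cst.
    apply: measurable_and; first exact: measurable_cst.
    apply: measurable_fun_ltr; first exact: measurable_cst.
    by have [+ _] := mF; apply; exact: dyadic_itv.
  exact: (mb mD [set true]).
apply/seteqP; split=> [w [Dw /(tau_ltP u_ge0 _ _ _ au)[s [ts sa fs]]]|]; last first.
  move=> w [N _ [l /= lN [Dw /and3P[tl la fl]]]]; split=> //.
  by apply/(tau_ltP u_ge0 _ _ _ au); exists (dyadic u N l).
have s0u : 0 <= s <= u.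
  have /andP[t0 _] := tau_itv u_ge0 (H w) n k.
  by rewrite (le_trans t0 (ltW ts)) (le_trans (ltW sa)).
have cvg1 : dyadic u N (dyadic_floor u N s) @[N --> \oo] --> s.
  apply: (dyadic_floor_cvg u_ge0 (f := id)) => //.
  by apply: continuous_subspaceT => r; exact: cvg_id.
have cvg2 := dyadic_floor_cvg u_ge0 (mF.2 w Dw) s0u.
have [N _ HN] : \forall N \near \oo,
    [&& tau u (H w) n k < dyadic u N (dyadic_floor u N s),
      dyadic u N (dyadic_floor u N s) < a &
      2 ^- n < frobenius (H w (dyadic u N (dyadic_floor u N s)) - H w (tau u (H w) n k))].
  have c1 := cvgr_gt _ cvg1 _ ts; have c2 := cvgr_lt _ cvg1 _ sa.
  have c3 := cvgr_gt _ cvg2 _ fs.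
  near=> N; apply/and3P; split; near: N; [exact: c1|exact: c2|exact: c3].
exists N => //; exists (dyadic_floor u N s); first exact: dyadic_floor_le.
by split => //; apply: HN => /=.
Unshelve. all: by end_near. Qed.

Variable X : Om -> cpath u d.
Hypothesis mxX : mxproc (fun w => X w).

(** The sum of the first [K] terms of the series defining [endo_sum]. *)
Let partial_sum n K (w : Om) (s : R) : 'cV[R]_m := \sum_(0 <= k < K)
  H w (tau u (H w) n k) *m
    (X w (Num.min s (tau u (H w) n k.+1)) - X w (Num.min s (tau u (H w) n k))).

Lemma endo_sum_stationary n w : D w ->
  exists K0, forall K s, (K0 <= K)%N -> 0 <= s <= u ->
  endo_sum (H w) (X w) n s = partial_sum n K w s.
Proof.
move=> Dw; have [K0 HK] := tau_end u_ge0 n (mxH.2 w Dw).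
exists K0 => K s K0K s0u.
have stat L : (K0 <= L)%N -> partial_sum n L w s = partial_sum n K0 w s.
  move=> K0L; rewrite /partial_sum (@big_cat_nat _ _ _ K0 0 L)// -[RHS]addr0.
  congr (_ + _).
  rewrite big_nat big1//.
  move=> k /andP[K0k _]; rewrite !HK ?(leq_trans K0k)//.
  by rewrite subrr mulmx0.
rewrite (stat K)//; apply: lim_near_cst => //.
by exists K0 => // L /= K0L; exact: stat.
Qed.

Lemma mproc_endo_sum n i : mproc u D (fun w s => endo_sum (H w) (X w) n s i 0).
Proof.
apply: (mproc_unif_lim (Z := fun K w s => partial_sum n K w s i 0)); last first.
  move=> w Dw e e0; have [K0 HK0] := endo_sum_stationary n Dw.
  by exists K0 => K K0K s s0u; rewrite (HK0 K)// subrr normr0.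
move=> K; apply: (@eq_mproc _ _ _ _ _ (fun w s => \sum_(k < K) \sum_(j < d)
  H w (tau u (H w) n k) i j *
    (X w (Num.min s (tau u (H w) n k.+1)) j 0 - X w (Num.min s (tau u (H w) n k)) j 0))).
  move=> w s _ _; rewrite /partial_sum big_mkord summxE; apply: eq_bigr => k _.
  by rewrite mxE; apply: eq_bigr => j _; rewrite !mxE.
have t0u k w : D w -> 0 <= tau u (H w) n k <= u by move=> _; exact: tau_itv.
apply: mproc_sum => k; apply: mproc_sum => j; apply: mprocM.
  apply: mproc_time_cst.
  apply: measurable_mproc_at (mxproc_coord i j mxH) _ (t0u k) => //.
  exact: measurable_tau.
apply: mprocB; apply: (mproc_stopped u_ge0 mD (mxproc_coord j 0 mxX) _ (t0u _));
  exact: measurable_tau.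
Qed.

Lemma continuous_cadlag h : {within `[0, u], continuous h} -> @cadlag R u m d h.
Proof.
move=> /within_continuousP ch; split=> [s /andP[s0 su]|s /andP[s0 su]].
  apply/cvgrPdist_lt => e e0.
  have [|del del0 Hd] := ch s _ e e0; first by rewrite s0 ltW.
  near=> r.
  have sr : s < r by near: r; exact: nbhs_right_gt.
  have ru : r < u by near: r; exact: nbhs_right_lt.
  have rs : r - s < del by near: r; exact: nbhs_right_ltDr.
  apply: Hd; first by rewrite (le_trans s0 (ltW sr)) ltW.
  by rewrite ltr0_norm; lra.
apply/cvg_ex; exists (h s); apply/cvgrPdist_lt => e e0.
have [|del del0 Hd] := ch s _ e e0; first by rewrite ltW.
near=> r.
have rs : r < s by near: r; exact: nbhs_left_lt.
have r0 : 0 < r by near: r; exact: nbhs_left_gt.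
have sr : s - r < del by near: r; exact: nbhs_left_ltBl.
apply: Hd; first by rewrite ltW//= (le_trans (ltW rs)).
by rewrite gtr0_norm; lra.
Unshelve. all: by end_near. Qed.

(** Continuous integrands are cadlag, so that membership in the domain amounts to
uniform convergence of each coordinate of the approximating sums. *)
Lemma DhatP w : D w -> Dhat (H w, X w) <->
  forall i, exists l, unif_cvg u (fun n s => endo_sum (H w) (X w) n s i 0) l.
Proof.
move=> Dw; split=> [[_ [l /unif_cvgP/coordwise_unif_cvg Hl]] i|Hl].
  by exists (fun s => l s i 0); exact: Hl.
split; first by apply: continuous_cadlag; exact: mxH.2.
have [l {}Hl] := choice Hl; exists (fun s => \col_i l i s).
apply/unif_cvgP/coordwise_unif_cvg => i j; rewrite ord1.
by apply: eq_unif_cvg (Hl i) => s _; rewrite mxE.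
Qed.

Lemma measurable_Dhat : measurable [set w | D w /\ Dhat (H w, X w)].
Proof.
rewrite (_ : [set _ | _] = D `&` \bigcap_(i in [set: 'I_m])
  [set w | D w /\ exists l, unif_cvg u (fun n s => endo_sum (H w) (X w) n s i 0) l]).
  apply: measurableI => //; apply: fin_bigcap_measurable => // i _.
  apply: (measurable_mproc_unif_cvg u_ge0
    (Z := fun n w s => endo_sum (H w) (X w) n s i 0)) => //.
  by move=> n; exact: mproc_endo_sum.
apply/seteqP; split=> w [Dw Hw]; split=> //.
  by move=> i _; split=> //; exact: (DhatP Dw).1.
by apply/(DhatP Dw) => i; have [] := Hw i I.
Qed.

Lemma mproc_Ihat i : (forall w, D w -> Dhat (H w, X w)) ->
  mproc u D (fun w s => Ihat (H w) (X w) s i 0).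
Proof.
move=> HD; apply: (mproc_unif_lim (Z := fun n w s => endo_sum (H w) (X w) n s i 0)).
  by move=> n; exact: mproc_endo_sum.
move=> w Dw; have [_ [l /unif_cvgP Hl]] := HD w Dw.
apply: (@eq_unif_cvg _ _ _ _ (fun s => l s i 0)).
  by move=> s s0u; rewrite /Ihat (cvg_lim _ (unif_cvg_pointwise Hl s0u))//.
exact: ((coordwise_unif_cvg _ _ _).1 Hl i 0).
Qed.

End measurable_endogenous_sums.

(** * Compatibility with restriction of paths *)

Lemma restrE {R : realType} n (t T : R) (tT : t <= T) (x : cpath T n) s :
  0 <= s <= t -> restr tT x s = x s.
Proof.
move=> s0t; rewrite -[LHS]/(('valL_0 \o sigL `[0, t]%classic) (x : R -> _) s).
by rewrite sigLK /patch mem_set//= in_itv.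
Qed.

Lemma cpath_continuous {R : realType} (u : R) n (x : cpath u n) :
  {within `[0, u], continuous (x : R -> _)}.
Proof.
by apply/subspace_valL_continuousP'; exact: cts_fun.
Qed.

Lemma eq_is_RS_integral {R : realType} (f f' g g' : R -> R) a b v :
  (forall s, a <= s <= b -> f s = f' s) -> (forall s, a <= s <= b -> g s = g' s) ->
  is_RS_integral f g a b v -> is_RS_integral f' g' a b v.
Proof.
move=> ff gg H e /H[del del0 {}H]; exists del => // s xi ps xis.
rewrite (_ : \sum_(0 <= k < size s) _ = \sum_(0 <= k < size s)
  f (xi k) * (g (nth b s k) - g (nth b (a :: s) k))); first exact: H.
rewrite !big_nat; apply: eq_bigr => k /= ks.
have [/andP[axi xib] _] := xis k ks.
have pa : a <= nth b (a :: s) k by apply: itv_partition_nth_ge ps; rewrite ltnS ltnW.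
have pb : nth b (a :: s) k.+1 <= b by apply: itv_partition_nth_le ps.
rewrite ff ?(le_trans pa axi) ?(le_trans xib pb)// !gg//.
  by rewrite pa (le_trans axi) ?(le_trans xib).
by rewrite /= in pb; rewrite pb andbT (le_trans pa) ?(le_trans axi).
Qed.

Lemma eq_RS_integral {R : realType} (f f' g g' : R -> R) a b :
  (forall s, a <= s <= b -> f s = f' s) -> (forall s, a <= s <= b -> g s = g' s) ->
  RS_integral f g a b = RS_integral f' g' a b.
Proof.
move=> ff gg; rewrite /RS_integral; congr (get _); apply/seteqP; split=> v.
  exact: eq_is_RS_integral.
by apply: eq_is_RS_integral => s sab; [rewrite ff|rewrite gg].
Qed.

Lemma eq_bounded_variation {R : realType} (g g' : R -> R) a b :
  (forall s, a <= s <= b -> g s = g' s) ->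
  bounded_variation a b g -> bounded_variation a b g'.
Proof.
move=> gg [M HM]; exists M => _ [s ps <-]; apply: HM; exists s => //.
rewrite /variation !big_nat; apply: eq_bigr => k /= ks.
have H l : (l < (size s).+1)%N -> a <= nth b (a :: s) l <= b.
  by move=> ls; rewrite (itv_partition_nth_ge ls ps) (itv_partition_nth_le ls ps).
by rewrite (gg _ (H k.+1 ks)) (gg _ (H k (ltnW ks))).
Qed.

Section restriction_of_stopped_sums.
Context {R : realType} (t T : R) (m d : nat).
Hypothesis t_ge0 : 0 <= t.
Hypothesis tT : t <= T.
Let T_ge0 : 0 <= T := le_trans t_ge0 tT.
Variables (h h' : R -> 'M[R]_(m, d)).
Hypothesis hh' : forall s, 0 <= s <= t -> h' s = h s.

(** The two families of stopping times coincide until the first one reaches [t]. *)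
Lemma tau_restr n k : tau t h' n k = Num.min (tau T h n k) t.
Proof.
elim: k => [|k ih]; first by rewrite /= min_l.
have itv' := tau_itv t_ge0 h' n k; have itv := tau_itv T_ge0 h n k.
have nxt' := tau_itv t_ge0 h' n k.+1; have nxt := tau_itv T_ge0 h n k.+1.
have [tk|tk] := leP t (tau T h n k).
  have e' : tau t h' n k = t by rewrite ih min_r.
  have := tau_le t_ge0 h' n k; rewrite e' => le1.
  rewrite min_r; first by apply/eqP; rewrite eq_le le1; case/andP: nxt' => _ ->.
  by rewrite (le_trans tk)// tau_le.
have e' : tau t h' n k = tau T h n k by rewrite ih min_l// ltW.
have lt_equiv a : a <= t -> (tau t h' n k.+1 < a) = (tau T h n k.+1 < a).
  move=> at_; apply/idP/idP.
    move=> /(tau_ltP t_ge0 _ _ _ at_)[s [ts sa fs]].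
    apply/(tau_ltP T_ge0 _ _ _ (le_trans at_ tT)); exists s; split => //.
      by rewrite -e'.
    move: fs; rewrite e' !hh'//.
      by case/andP: itv => -> _; rewrite ltW.
    by case/andP: itv' => t0 _; rewrite (le_trans t0 (ltW ts)) (le_trans (ltW sa)).
  move=> /(tau_ltP T_ge0 _ _ _ (le_trans at_ tT))[s [ts sa fs]].
  apply/(tau_ltP t_ge0 _ _ _ at_); exists s; split => //; first by rewrite e'.
  rewrite e' !hh'//.
    by case/andP: itv => -> _; rewrite ltW.
  by case/andP: itv => t0 _; rewrite (le_trans t0 (ltW ts)) (le_trans (ltW sa)).
case/andP: nxt' => _ nt'.
apply/eqP; rewrite eq_le le_min nt' andbT; apply/andP; split.
  rewrite leNgt; apply/negP => lt1; have := lt_equiv _ nt'.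
  by rewrite ltxx lt1.
have [le1|lt1] := leP (tau T h n k.+1) t.
  rewrite leNgt; apply/negP => lt2; have := lt_equiv _ le1.
  by rewrite ltxx lt2.
rewrite leNgt; apply/negP => lt2; move: (lt_equiv _ (lexx t)).
by rewrite lt2 => /esym /(lt_trans lt1); rewrite ltxx.
Qed.

Variables (x : cpath T d) (x' : cpath t d).
Hypothesis xx' : forall s, 0 <= s <= t -> x' s = x s.

(** Although the integrands may differ after [t], the terms in which they are
evaluated there have a zero increment. *)
Lemma endo_sum_restr n s : 0 <= s <= t -> endo_sum h' x' n s = endo_sum h x n s.
Proof.
move=> s0t; rewrite /endo_sum; congr (limn (series _)); apply/funext => k.
case/andP: (s0t) => s0 st.
have mint l : Num.min s (tau t h' n l) = Num.min s (tau T h n l).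
  by rewrite tau_restr minCA (min_l st) minC.
rewrite !mint.
have min0t l : 0 <= Num.min s (tau T h n l) <= t.
  have /andP[t0 _] := tau_itv T_ge0 h n l.
  by rewrite le_min s0 t0 ge_min st.
rewrite !xx'//; have [tk|tk] := leP t (tau T h n k).
  have tk1 := le_trans tk (tau_le T_ge0 h n k).
  by rewrite !min_l ?(le_trans st)// subrr !mulmx0.
rewrite tau_restr min_l ?(ltW tk)// hh'//.
by have /andP[-> _] := tau_itv T_ge0 h n k; rewrite ltW.
Qed.

Lemma Ihat_restr s : 0 <= s <= t -> Ihat h' x' s = Ihat h x s.
Proof.
by move=> s0t; rewrite /Ihat; congr (limn _); apply/funext => n; exact: endo_sum_restr.
Qed.

Lemma Dhat_restr : cadlag t h' -> Dhat (h, x) -> Dhat (h', x').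
Proof.
move=> ch' [_ [l /unif_cvgP Hl]]; split=> //; exists l; apply/unif_cvgP.
apply: (@eq_unif_cvgl _ _ _ (endo_sum h x)).
  by move=> n s s0t; rewrite endo_sum_restr.
move=> e /Hl[N HN]; exists N => n Nn s /andP[s0 st]; apply: HN => //.
by rewrite s0 (le_trans st).
Qed.

End restriction_of_stopped_sums.

(** * The solution relation *)

Section path_space.
Context {R : realType} (u : R) (n : nat).

(** Generated sigma-algebras are structures on pointed types; the point chosen on
the path space is the zero path. *)
HB.instance Definition _ := isPointed.Build (cpath u n)
  (mkcts (@cst_continuous (set_type `[0, u]%classic) _ (0 : 'cV[R]_n)) :
    continuousType (set_type `[0, u]%classic) 'cV[R]_n).

Lemma cpath_eval_continuous s : 0 <= s <= u ->
  continuous (fun x : cpath u n => x s).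
Proof.
move=> s0u; have sA : s \in `[0, u]%classic by rewrite mem_set//= in_itv.
pose p : set_type `[0, u]%classic := SigSub sA.
have eval_uniform : continuous
    (fun h : {uniform (set_type `[0, u]%classic) -> 'cV[R]_n} => h p).
  move=> h P /nbhs_ballP[e /= e0 eP].
  apply/uniform_nbhs; exists [set xy | ball xy.1 e xy.2]; split.
    exact: (@entourage_ball _ 'cV[R]_n (PosNum e0)).
  by move=> g /(_ p I) /= hg; exact: eP.
rewrite (_ : (fun x => _) = (fun h => h p) \o @cpath_uniform R u n); last first.
  apply/funext => y; rewrite -[RHS]/(cpath_uniform y p).
  have <- := congr1 (fun g => g (cpath_uniform y) p)
    (@sigL_valL _ _ (0 : 'cV[R]_n) `[0, u]%classic).
  by [].
have ci : continuous (@cpath_uniform R u n).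
  exact: (@initial_continuous _ _ (@cpath_uniform R u n)).
by move=> x P HP; exact: (ci x _ (eval_uniform (cpath_uniform x) P HP)).
Qed.

End path_space.

Lemma slice_continuous {R : realType} (T s : R) (q m d : nat)
    (F : R * 'cV[R]_q -> 'M[R]_(m, d)) :
  {within `[0, T] `*` setT, continuous F} -> 0 <= s <= T ->
  continuous (fun v => F (s, v)).
Proof.
move=> /subspace_continuousP cF s0T v.
apply: (@cvg_comp _ _ _ (fun v => (s, v)) F _
  (within (`[0, T] `*` setT) (nbhs (s, v)))); last first.
  by apply: cF; split=> //=; rewrite in_itv.
move=> P [[A B] /= [As Bv] AB]; apply: filterS Bv => v' Bv'.
apply: (AB (s, v')); first by split=> //; exact: nbhs_singleton As.
by split=> //=; rewrite in_itv.
Qed.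

Lemma along_path_continuous {R : realType} (t T : R) (q m d : nat)
    (F : R * 'cV[R]_q -> 'M[R]_(m, d)) (y : R -> 'cV[R]_q) : t <= T ->
  {within `[0, T] `*` setT, continuous F} -> {within `[0, t], continuous y} ->
  {within `[0, t], continuous (fun s => F (s, y s))}.
Proof.
move=> tT /subspace_continuousP cF /subspace_continuousP cy.
apply/subspace_continuousP => s s0t.
have sub r : `[0, t]%classic r -> `[0, T]%classic r.
  by rewrite /= !in_itv /= => /andP[-> /le_trans]; apply.
apply: (@cvg_comp _ _ _ (fun s => (s, y s)) F _
  (within (`[0, T] `*` setT) (nbhs (s, y s)))); last first.
  by apply: cF; split=> //; exact: sub.
move=> P [[A B] /= [As Bys] AB].
have HA : within `[0, t] (nbhs s) A by apply: filterS As => r.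
have HB := cy s s0t _ Bys.
have Ht : within `[0, t] (nbhs s) `[0, t]%classic by exact: withinT.
apply: filterS3 Ht HA HB => r r0t Ar Br; apply: (AB (r, y r)) => //.
by split=> //; exact: sub.
Qed.

Section solution_relation_borel.
Context {R : realType} (t T : R) (d q : nat).
Hypotheses (t_ge0 : 0 <= t) (tT : t <= T).

(** The space of pairs of paths with its Borel sigma-algebra. *)
Let Om := g_sigma_algebraType (@open (cpath t d * cpath t q)%type).
Local Notation pathx w := (w.1 : cpath t d).
Local Notation pathy w := (w.2 : cpath t q).

Lemma measurable_continuous (f : cpath t d * cpath t q -> R) : continuous f ->
  measurable_fun setT (f : Om -> R).
Proof.
move=> cf; apply: measurable_fun_lt => // a; rewrite setTI.
apply: sub_sigma_algebra.
rewrite -[X in open X]/(f @^-1` [set r | r < a]).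
by apply: open_comp => [w _|]; [exact: cf|exact: open_lt].
Qed.


(** Evaluations of paths are continuous for the uniform topology, hence Borel. *)
Lemma mxproc_x : mxproc t setT (fun w : Om => cpath_eval (pathx w)).
Proof.
split=> [s s0t i j|w _]; last exact: cpath_continuous.
apply: measurable_continuous => w P HP.
have H1 := @coord_continuous _ _ _ i j ((pathx w) s) _ HP.
have H2 := @cpath_eval_continuous R t d s s0t (pathx w) _ H1.
exists ([set x : cpath t d | P (x s i j)], setT).
  by split; [exact: H2|exact: filterT].
by move=> v [].
Qed.

Lemma mxproc_along_y m p (F : R * 'cV[R]_q -> 'M[R]_(m, p)) :
  {within `[0, T] `*` setT, continuous F} ->
  mxproc t setT (fun (w : Om) s => F (s, (pathy w) s)).
Proof.
move=> cF; split=> [s s0t i j|w _]; last first.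
  exact: along_path_continuous tT cF (@cpath_continuous _ _ _ (pathy w)).
apply: measurable_continuous => w P HP.
have s0T : 0 <= s <= T by case/andP: s0t => -> /le_trans ->.
have H0 := @coord_continuous _ _ _ i j (F (s, (pathy w) s)) _ HP.
have H1 := slice_continuous cF s0T H0.
have H2 := @cpath_eval_continuous R t q s s0t (pathy w) _ H1.
exists (setT, [set y : cpath t q | P (F (s, y s) i j)]).
  by split; [exact: filterT|exact: H2].
by move=> v [].
Qed.

Lemma mxproc_subset (D D' : set Om) m p (H : Om -> R -> 'M[R]_(m, p)) :
  measurable D -> D' `<=` D -> mxproc t D H -> mxproc t D' H.
Proof.
move=> mD DD' [mH cH]; split=> [s s0t i j|w /DD'/cH//].
exact: measurable_funS mD DD' (mH s s0t i j).
Qed.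

Lemma chi_continuous (x : cpath t d) i j : {within `[0, t], continuous (chi i j x)}.
Proof.
move=> s; have cx := @cpath_continuous _ _ _ x s.
have : x r i 0 @[r --> nbhs (s : subspace `[0, t])] --> x s i 0.
  apply: (@cvg_comp _ _ _ x (fun M => M i 0) _ (nbhs (x s))) => //.
  exact: coord_continuous.
by move=> /(cvgZr_tmp (a := delta_mx 0 j)); apply.
Qed.

Lemma mxproc_chi i j : mxproc t setT (fun w : Om => chi i j (pathx w)).
Proof.
split=> [s s0t k l|w _]; last exact: chi_continuous.
apply: (eq_measurable_fun (fun w : Om =>
  (pathx w) s i 0 * (delta_mx 0 j : 'M[R]_(1, d)) k l)).
  by move=> w _; rewrite /chi [RHS]mxE.
by apply: measurable_funM; [exact: mxproc_x.1|exact: measurable_cst].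
Qed.

Let Dqv_set : set Om := [set w | Dqv (pathx w)].

Lemma measurable_Dqv : measurable Dqv_set.
Proof.
rewrite (_ : Dqv_set = \bigcap_(ij in [set: 'I_d * 'I_d])
    [set w : Om | setT w /\ Dhat (chi ij.1 ij.2 (pathx w), (pathx w))]).
  apply: fin_bigcap_measurable => // -[i j] _.
  exact: (measurable_Dhat t_ge0 measurableT (mxproc_chi i j) mxproc_x).
apply/seteqP; split=> w Hw; first by move=> [i j] _; split=> //; exact: Hw.
by move=> i _ j _; have [] := Hw (i, j) I.
Qed.

Lemma mproc_Qcov i j : mproc t Dqv_set (fun w => Qcov i j (pathx w)).
Proof.
have mx := mxproc_subset measurableT (@subsetT _ Dqv_set) mxproc_x.
have xi i' := mxproc_coord i' 0 mx.
have I0 i' j' : mproc t Dqv_set (fun w s => Ihat (chi i' j' (pathx w)) (pathx w) s 0 0).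
  apply: (mproc_Ihat t_ge0 measurable_Dqv _ mx 0).
    exact: mxproc_subset measurableT (@subsetT _ _) (mxproc_chi i' j').
  by move=> w; apply.
have t0 : 0 <= (0 : R) <= t by rewrite lexx.
do 2 (apply: mprocB => //); apply: mprocB; first exact: mprocM.
by apply: mproc_time_cst; apply: measurable_funM; apply: mx.1.
Qed.

Let Gqv_set : set Om := [set w | Gqv (pathx w)].

(** Only bounded variation has to be tested: on its domain, the covariation is a
uniform limit of continuous paths, hence continuous. *)
Lemma measurable_Gqv : measurable Gqv_set.
Proof.
rewrite (_ : Gqv_set = Dqv_set `&` \bigcap_(ij in [set: 'I_d * 'I_d])
    [set w : Om | Dqv_set w /\ bounded_variation 0 t (Qcov ij.1 ij.2 (pathx w))]).
  apply: measurableI; first exact: measurable_Dqv.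
  apply: fin_bigcap_measurable => // -[i j] _.
  exact: (measurable_mproc_bounded_variation t_ge0 measurable_Dqv (mproc_Qcov i j)).
apply/seteqP; split=> w [Dw Hw]; split=> //.
  by move=> [i j] _; split=> //; have [] := Hw i j.
move=> i j; split; last by have [] := Hw (i, j) I.
exact: (mproc_Qcov i j).2.
Qed.

Lemma borel_solution_rel (y0 : 'cV[R]_q) (b : R * 'cV[R]_q -> 'cV[R]_q)
    (beta : 'I_d -> 'I_d -> R * 'cV[R]_q -> 'cV[R]_q)
    (sigma : R * 'cV[R]_q -> 'M[R]_(q, d)) :
  {within `[0, T] `*` setT, continuous b} ->
  (forall i j, {within `[0, T] `*` setT, continuous (beta i j)}) ->
  {within `[0, T] `*` setT, continuous sigma} ->
  borel_set (solution_rel y0 b beta sigma t).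
Proof.
move=> cb cbeta csigma.
rewrite -[borel_set _]/(@measurable _ Om (solution_rel y0 b beta sigma t)).
have mxsigma := mxproc_along_y csigma.
have mG := measurable_Gqv.
pose D : set Om := [set w | Gqv_set w /\ Dhat (sigma_along sigma (pathy w), (pathx w))].
have mD : measurable D.
  by apply: (measurable_Dhat t_ge0 mG);
    apply: mxproc_subset measurableT (@subsetT _ _) _ => //; exact: mxproc_x.
have mQ i j : mproc t D (fun w => Qcov i j (pathx w)).
  by apply: mproc_subset (measurable_Dqv) _ (mproc_Qcov i j) => w [[]].
have mx := mxproc_subset measurableT (@subsetT _ D) mxproc_x.
have csnd : {within `[0, T] `*` setT, continuous (@snd R 'cV[R]_q)}.
  by apply: continuous_subspaceT => p; exact: cvg_snd.
have my := mxproc_subset measurableT (@subsetT _ D) (mxproc_along_y csnd).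
(* The [k]-th coordinate of the right-hand side of the equation. *)
pose rhs (w : Om) (s : R) (k : 'I_q) : R := y0 k 0
  + \int[lebesgue_measure]_(r in `[0, s]) b (r, (pathy w) r) k 0
  + \sum_(i < d) \sum_(j < d)
      RS_integral (fun r => beta i j (r, (pathy w) r) k 0) (Qcov i j (pathx w)) 0 s
  + Ihat (sigma_along sigma (pathy w)) (pathx w) s k 0.
have mrhs k : mproc t D (fun w s => rhs w s k).
  apply: mprocD; last first.
    apply: (mproc_Ihat t_ge0 mD _ mx) => [|w []//].
    exact: mxproc_subset measurableT (@subsetT _ _) mxsigma.
  apply: mprocD; last first.
    apply: mproc_sum => i; apply: mproc_sum => j; apply: mproc_RS_integral => //.
      apply: mxproc_coord.
      exact: mxproc_subset measurableT (@subsetT _ _) (mxproc_along_y (cbeta i j)).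
    by move=> w [[_ Hw] _]; have [] := Hw i j.
  apply: mprocD; first exact/mproc_time_cst/measurable_cst.
  apply: mproc_Rintegral => //; apply: mxproc_coord.
  exact: mxproc_subset measurableT (@subsetT _ _) (mxproc_along_y cb).
have rhsE (w : Om) s k : (y0
    + \col_k (\int[lebesgue_measure]_(r in `[0, s]) b (r, (pathy w) r) k 0)
    + \sum_(i < d) \sum_(j < d)
        \col_k RS_integral (fun r => beta i j (r, (pathy w) r) k 0)
                           (Qcov i j (pathx w)) 0 s
    + Ihat (sigma_along sigma (pathy w)) (pathx w) s) k 0 = rhs w s k.
  rewrite !mxE summxE /rhs; congr (_ + _ + _ + _); apply: eq_bigr => i _.
  by rewrite summxE; apply: eq_bigr => j _; rewrite mxE.
rewrite (_ : solution_rel _ _ _ _ _ = (\bigcap_(k in [set: 'I_q])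
    [set w : Om | D w /\ forall s, 0 <= s <= t -> `|(pathy w) s k 0 - rhs w s k| <= 0])
    `&` D).
  apply: measurableI => //; apply: fin_bigcap_measurable => // k _.
  apply: (measurable_mproc_le t_ge0 0 mD); apply/mproc_norm/mprocB => //.
  by apply: (mxproc_coord k 0 my).
apply/seteqP; split=> w.
  move=> [Gw Sw eqw]; split=> //; move=> k _; split=> // s s0t.
  by rewrite eqw// rhsE subrr normr0.
move=> [Hw [Gw Sw]]; split=> // s s0t; apply/colP => k; rewrite rhsE.
have [_ /(_ s s0t)] := Hw k I.
by rewrite normr_le0 subr_eq0 => /eqP.
Qed.

End solution_relation_borel.

Lemma solution_rel_restr {R : realType} (t T : R) (d q : nat)
    (t_ge0 : 0 <= t) (tT : t <= T)
    (y0 : 'cV[R]_q) (b : R * 'cV[R]_q -> 'cV[R]_q)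
    (beta : 'I_d -> 'I_d -> R * 'cV[R]_q -> 'cV[R]_q)
    (sigma : R * 'cV[R]_q -> 'M[R]_(q, d)) (x : cpath T d) (y : cpath T q) :
  {within `[0, T] `*` setT, continuous sigma} ->
  solution_rel y0 b beta sigma T (x, y) ->
  solution_rel y0 b beta sigma t (restr tT x, restr tT y).
Proof.
move=> csigma [/= [Dx Qx] Sx eqx].
have rx s : 0 <= s <= t -> restr tT x s = x s by exact: restrE.
have ry s : 0 <= s <= t -> restr tT y s = y s by exact: restrE.
have chiE i j s : 0 <= s <= t -> chi i j (restr tT x) s = chi i j x s.
  by move=> s0t; rewrite /chi rx.
have sigE s : 0 <= s <= t ->
    sigma_along sigma (restr tT y) s = sigma_along sigma y s.
  by move=> s0t; rewrite /sigma_along ry.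
have z0t : 0 <= (0 : R) <= t by rewrite lexx.
have QE i j s : 0 <= s <= t -> Qcov i j (restr tT x) s = Qcov i j x s.
  move=> s0t; rewrite /Qcov (rx s s0t) (rx 0 z0t).
  rewrite (Ihat_restr t_ge0 tT (chiE i j) rx s0t).
  by rewrite (Ihat_restr t_ge0 tT (chiE j i) rx s0t).
have sub : `[0, t]%classic `<=` `[0, T]%classic.
  by move=> s /=; rewrite !in_itv /= => /andP[-> /le_trans]; apply.
split=> /=.
- split=> [i _ j _|i j].
    apply: (Dhat_restr t_ge0 tT (chiE i j) rx); last exact: Dx.
    by apply: continuous_cadlag; exact: chi_continuous.
  have [cQ bvQ] := Qx i j; split.
    apply: (@eq_within_continuous _ _ _ (Qcov i j x)).
      by move=> s s0t; rewrite QE.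
    exact: continuous_subspaceW sub cQ.
  apply: (@eq_bounded_variation _ (Qcov i j x)).
    by move=> s s0t; rewrite QE.
  exact: bounded_variationl bvQ.
- apply: (Dhat_restr t_ge0 tT sigE rx) => //.
  apply: continuous_cadlag.
  exact: (along_path_continuous tT csigma (@cpath_continuous _ _ _ _)).
move=> s /andP[s0 st]; have s0t : 0 <= s <= t by rewrite s0.
have s0T : 0 <= s <= T by rewrite s0 (le_trans st).
rewrite (ry s s0t) (eqx s s0T).
have in0t r : 0 <= r <= s -> 0 <= r <= t by move=> /andP[-> /le_trans]; apply.
apply: (congr2 +%R); last exact: esym (Ihat_restr t_ge0 tT sigE rx s0t).
apply: (congr2 +%R).
  apply: (congr1 (+%R y0)); apply: eq_mx => k _.
  apply: eq_Rintegral => r; rewrite inE /= in_itv /= => /in0t r0t.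
  by rewrite (ry r r0t).
apply: eq_bigr => i _; apply: eq_bigr => j _; apply: eq_mx => k _.
by apply: eq_RS_integral => r /in0t r0t; [rewrite (ry r r0t)|rewrite (QE i j r r0t)].
Qed.

Theorem proposition4p8 (R : realType) (T : R) (T_gt0 : 0 < T)
  (d q : nat) (d_gt0 : (0 < d)%N) (q_gt0 : (0 < q)%N)
  (y0 : 'cV[R]_q)
  (b : R * 'cV[R]_q -> 'cV[R]_q)
  (beta : 'I_d -> 'I_d -> R * 'cV[R]_q -> 'cV[R]_q)
  (sigma : R * 'cV[R]_q -> 'M[R]_(q, d))
  (b_cont : {within `[0, T] `*` setT, continuous b})
  (beta_cont : forall i j, {within `[0, T] `*` setT, continuous (beta i j)})
  (sigma_cont : {within `[0, T] `*` setT, continuous sigma})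
  (b_bnd : locally_bounded_on (`[0, T] `*` setT) b)
  (beta_bnd : forall i j, locally_bounded_on (`[0, T] `*` setT) (beta i j))
  (sigma_bnd : locally_bounded_on (`[0, T] `*` setT) sigma) :
  forall (t : R) (t_ge0 : 0 <= t) (t_leT : t <= T),
    borel_set (solution_rel y0 b beta sigma t) /\
    (forall (x : cpath T d) (y : cpath T q),
       solution_rel y0 b beta sigma T (x, y) ->
       solution_rel y0 b beta sigma t (restr t_leT x, restr t_leT y)).
Proof.
move=> t t_ge0 t_leT; split; last first.
  by move=> x y; exact: solution_rel_restr.
exact: (borel_solution_rel t_ge0 t_leT y0 b_cont beta_cont sigma_cont).
Qed.
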